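(* Let $f\in F^2$. For all real numbers $a$ and $b$, $$\|f'+zf-af\|\,\|f'-zf-ibf\|\ge\|f\|^2 .$$ Furthermore, for given real $a$ and $b$, equality holds if and only if there exist a positive constant $c$ and a complex constant $C$ such that $$f(z)=C\exp\left(\frac{c-1}{2(c+1)}z^2+\frac{a+ibc}{c+1}z\right).$$
   Context: The Fock space is $F^2=L^2(\mathbb{C},d\lambda)\cap H(\mathbb{C})$, where $H(\mathbb{C})$ is the space of entire functions and $d\lambda(z)=\frac1\pi e^{-|z|^2}dA(z)$ with $dA$ ordinary area measure. It is a Hilbert space with $\langle f,g\rangle=\int_{\mathbb{C}} f\overline{g}\,d\lambda$ and $\|f\|^2=\int_{\mathbb{C}}|f|^2\,d\lambda$. Here $f'$ is the complex derivative, $zf$ denotes the function $z\mapsto zf(z)$, and $i$ is the imaginary unit. For an entire function $g$ not in $F^2$ we set $\|g\|=+\infty$; when $f'\notin F^2$ (equivalently $zf\notin F^2$) the left-hand side is regarded as $+\infty$, so the inequality is trivially true (and strict). *)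

(* Defs.v *)
From HB Require Import structures.
From mathcomp Require Import all_boot all_order all_algebra complex.
From mathcomp Require Import all_classical all_reals all_analysis.

Set Implicit Arguments.
Unset Strict Implicit.
Unset Printing Implicit Defensive.

Import Order.TTheory GRing.Theory Num.Theory.
Import numFieldNormedType.Exports.

Local Open Scope classical_set_scope.
Local Open Scope ring_scope.
Local Open Scope complex_scope.

(* R[i]^o is R[i] as a normed space over itself: the increments in the
   difference quotients of entire and cderive are complex. *)
Definition entire (R : realType) (f : R[i] -> R[i]) : Prop :=
  forall z : R[i], derivable (f : R[i]^o -> R[i]^o) z 1.

Definition cderive (R : realType) (f : R[i] -> R[i]) : R[i] -> R[i] :=
  derive1 (f : R[i] -> R[i]^o).

Definition expC (R : realType) (z : R[i]) : R[i] :=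
  let: x +i* y := z in (expR x)%:C * (cos y +i* sin y).

Definition fock_density (R : realType) (z : R[i]) : R :=
  pi^-1 * expR (- Normc.normc z ^+ 2).

(* C is identified with R * R, on which the area measure dA is the product
   Lebesgue measure. The integrand is nonnegative, so the norm of an entire
   function that is not square integrable is +oo. *)
Definition fock_norm (R : realType) (f : R[i] -> R[i]) : \bar R :=
  sqrte (\int[lebesgue_measure \x lebesgue_measure]_(p in [set: R * R])
    (Normc.normc (f (p.1 +i* p.2)) ^+ 2 * fock_density (p.1 +i* p.2))%R%:E)%E.

Definition fock_space (R : realType) (f : R[i] -> R[i]) : Prop :=
  entire f /\ (fock_norm f < +oo)%E.

(* Main.v *)
Require Import Defs.
From HB Require Import structures.
From mathcomp Require Import all_boot all_order all_algebra complex.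
From mathcomp Require Import all_classical all_reals all_analysis measurable_realfun.
From mathcomp Require Import ring lra.

(** Write u = f' + z f - a f and v = f' - z f - i b f, let w be the Gaussian
    density of the measure, and put A = |u|^2, B = |v|^2, N = |f|^2 for the
    squared norms.  On the Fock space d/dz and multiplication by z are adjoint
    to each other and their commutator is the identity, so the statement is the
    uncertainty principle for the symmetric operator d/dz + z and the
    skew-symmetric operator d/dz - z: everything follows from Re <u, v> = - N.

    That identity is an integration by parts in the plane.  By the
    Cauchy-Riemann equations the vector field with coordinates
    Re (u conj(f)) w and Im (f conj(v)) w has divergence
    2 (Re (u conj(v)) + |f|^2) w ([real_commutator_identity]).  When f, u and v
    have finite norm, the field and its divergence are both integrable, and
    then the divergence has integral zero over the plane ([divergence_eq0]).

    Hence 0 <= |u + t v|^2 = A - 2 t N + t^2 B for every real t, and t = N / B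
    gives N^2 <= A B, with equality only if u + c v = 0 for c = N / B.  The
    latter is the differential equation f' = (2 k z + d) f with
    k = (c - 1) / (2 (c + 1)) and d = (a + i b c) / (c + 1), whose solutions are
    the multiples of exp (k z^2 + d z) ([linear_ode_gaussian]).  Conversely
    such an f satisfies u = - c v, a Gaussian bound shows that u and v have
    finite norm ([linear_gaussian_lty]), and Re <u, v> = - N turns into c B = N,
    which is the equality.

    If one of the two norms is infinite, the product is infinite unless the
    other norm is zero, because 0 * oo = 0 among extended reals.  This cannot
    happen for f != 0: u = 0 makes f a multiple of exp (- z^2 / 2 + a z), for
    which |f|^2 w depends on the real part only and has infinite integral, and
    v = 0 is symmetric ([position_op_inj], [momentum_op_inj]).

    The integration by parts needs f'' to exist and be continuous, whereas f is
    only assumed to have a derivative at each point.  Goursat's theorem, proved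
    by bisection, provides a primitive F of f ([cdiff_primitive]); the mean
    value property of F over circles yields an integral formula for F' that can
    be differentiated under the integral sign, so that the derivative of an
    entire function is entire ([entire_cderive]).  The one-dimensional
    integrals in this part are increments of primitives, which makes them
    linear and additive at no cost. *)

Set Implicit Arguments.
Unset Strict Implicit.
Unset Printing Implicit Defensive.

Import Order.TTheory GRing.Theory Num.Theory.
Import numFieldNormedType.Exports.

Local Open Scope classical_set_scope.
Local Open Scope ring_scope.
Local Open Scope complex_scope.

Local Notation nrm := Normc.normc.
Local Notation re := (@complex.Re _).
Local Notation im := (@complex.Im _).
Local Notation plane R := (measurableTypeR R * measurableTypeR R)%type.
Local Notation area R := (@lebesgue_measure R \x @lebesgue_measure R)%E.

(** * Complex and real differentiability *)

Lemma nrmE (R : realType) (x y : R) : nrm (x +i* y) = Num.sqrt (x ^+ 2 + y ^+ 2).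
Proof. by []. Qed.

Lemma nrm_ge0 (R : realType) (z : R[i]) : 0 <= nrm z.
Proof. by case: z => x y; exact: sqrtr_ge0. Qed.

Lemma sqr_nrm (R : realType) (z : R[i]) : nrm z ^+ 2 = re z ^+ 2 + im z ^+ 2.
Proof. by case: z => x y; rewrite nrmE sqr_sqrtr// addr_ge0// sqr_ge0. Qed.

Lemma nrmN (R : realType) (z : R[i]) : nrm (- z) = nrm z.
Proof. exact: normcN. Qed.

Lemma nrmB (R : realType) (z w : R[i]) : nrm (z - w) = nrm (w - z).
Proof. by rewrite -nrmN opprB. Qed.

Lemma ler_nrmD (R : realType) (z w : R[i]) : nrm (z + w) <= nrm z + nrm w.
Proof. exact: le_normcD. Qed.

Lemma ler_nrmB (R : realType) (z w : R[i]) : nrm (z - w) <= nrm z + nrm w.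
Proof. by rewrite -(nrmN w); exact: ler_nrmD. Qed.

Lemma nrmM (R : realType) (z w : R[i]) : nrm (z * w) = nrm z * nrm w.
Proof. exact: Normc.normcM. Qed.

Lemma nrmR (R : realType) (x : R) : nrm x%:C = `|x|.
Proof. by rewrite nrmE expr0n /= addr0 sqrtr_sqr. Qed.

Lemma nrm_eq0 (R : realType) (z : R[i]) : (nrm z == 0) = (z == 0).
Proof.
apply/eqP/eqP => [|->]; first exact: Normc.eq0_normc.
exact: Normc.normc0.
Qed.

Lemma ler_Re_nrm (R : realType) (z : R[i]) : `|re z| <= nrm z.
Proof.
case: z => x y /=; rewrite -[`|x|]sqrtr_sqr ler_wsqrtr// lerDl.
exact: sqr_ge0.
Qed.

Lemma ler_Im_nrm (R : realType) (z : R[i]) : `|im z| <= nrm z.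
Proof.
case: z => x y /=; rewrite -[`|y|]sqrtr_sqr ler_wsqrtr// lerDr.
exact: sqr_ge0.
Qed.

Lemma ler_nrm_ReIm (R : realType) (z : R[i]) : nrm z <= `|re z| + `|im z|.
Proof.
rewrite -[leRHS]ger0_norm ?addr_ge0// -sqrtr_sqr.
case: z => x y /=; rewrite ler_wsqrtr//.
rewrite sqrrD !real_normK ?num_real// -addrA lerD2l.
by rewrite -[leLHS]add0r lerD2r mulrn_wge0// mulr_ge0.
Qed.

Lemma normCE (R : realType) (z : R[i]) : `|z| = (nrm z)%:C.
Proof. by case: z. Qed.

(** The error is measured by the real-valued modulus, so that increments are
    complex while all estimates take place in the ordered field R. *)
Definition cdiff (R : realType) (f : R[i] -> R[i]) (z l : R[i]) : Prop :=
  forall e : R, 0 < e -> exists2 d : R, 0 < d &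
    forall h, nrm h < d -> nrm (f (z + h) - f z - l * h) <= e * nrm h.

Lemma cdiffP (R : realType) (f : R[i] -> R[i]) (z l : R[i]) :
  cdiff f z l <->
  (fun h : R[i]^o => h^-1 *: ((f : R[i]^o -> R[i]^o) (h + z) - f z)) @ (0 : R[i]^o)^'
    --> (l : R[i]^o).
Proof.
split=> [H|].
- apply/cvgrPdist_le => -[e e2].
  rewrite ltcE/= => /andP[/eqP-> e0].
  have [d d0 hd] := H e e0.
  rewrite nearE /dnbhs /within; apply/nbhs_ballP.
  exists d%:C; first by rewrite /= ltcE/= eqxx.
  move=> h; rewrite -ball_normE /= sub0r normrN normCE ltcE/= eqxx/= => hh h0.
  rewrite normCE lecE/= eqxx/=.
  have h0' : 0 < nrm h by rewrite lt_neqAle nrm_ge0 andbT eq_sym nrm_eq0.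
  rewrite -(ler_pM2r h0') -nrmM mulrBl.
  have -> : h^-1 *: (f (h + z) - f z) * h = f (z + h) - f z.
    by rewrite -[_ *: _]/(_ * _) mulrAC mulVf// mul1r (addrC h).
  by rewrite nrmB; exact: hd.
- move/cvgrPdist_le => H e e0.
  have /H : (0 : R[i]) < e%:C by rewrite ltcE/= eqxx.
  rewrite nearE /dnbhs /within => /nbhs_ballP[[d d2]].
  rewrite /= ltcE/= => /andP[/eqP-> d0] hd.
  exists d => // h hh.
  have [->|h0] := eqVneq h 0.
    by rewrite addr0 subrr mulr0 subr0 Normc.normc0 mulr0.
  have := hd h; rewrite -ball_normE /= sub0r normrN normCE ltcE/= eqxx/=.
  move=> /(_ hh h0); rewrite normCE lecE/= eqxx/=.
  have h0' : 0 < nrm h by rewrite lt_neqAle nrm_ge0 andbT eq_sym nrm_eq0.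
  rewrite -(ler_pM2r h0') -nrmM mulrBl.
  have -> : h^-1 *: (f (h + z) - f z) * h = f (z + h) - f z.
    by rewrite -[_ *: _]/(_ * _) mulrAC mulVf// mul1r (addrC h).
  by rewrite nrmB.
Qed.

Lemma entire_cdiff (R : realType) (f : R[i] -> R[i]) : entire f ->
  forall z, cdiff f z (cderive f z).
Proof.
move=> ef z; apply/cdiffP.
rewrite /cderive /derive1.
have := ef z; rewrite /derivable.
rewrite (_ : (fun h : R[i] => _) = (fun h : R[i] => h^-1 *: ((f : R[i]^o ->
  R[i]^o) (h + z) - f z))) //.
apply/funext => h /=; by rewrite -[h *: 1]/(h * 1) mulr1.
Qed.

Lemma cdiff_entire (R : realType) (f g : R[i] -> R[i]) :
  (forall z, cdiff f z (g z)) -> entire f /\ cderive f = g.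
Proof.
move=> H; split.
  move=> z; have /cdiffP hz := H z; rewrite /derivable.
  apply/cvg_ex; exists (g z : R[i]^o).
  rewrite (_ : (fun h : R[i] => _) = (fun h : R[i] => h^-1 *: ((f : R[i]^o ->
    R[i]^o) (h + z) - f z))) //.
  apply/funext => h /=; by rewrite -[h *: 1]/(h * 1) mulr1.
apply/funext => z; have /cdiffP hz := H z.
rewrite /cderive /derive1.
exact: (cvg_lim (@norm_hausdorff _ (R[i]^o))).
Qed.

Lemma is_deriveP (R : realType) (g : R -> R) (t l : R) :
  is_derive t 1 g l <->
  forall e : R, 0 < e -> exists2 d : R, 0 < d &
    forall h, `|h| < d -> `|g (t + h) - g t - l * h| <= e * `|h|.
Proof.
have eqh (h : R) : h != 0 -> h^-1 *: (g (h *: 1 + t) - g t) * h = g (t + h) - g t.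
  by move=> h0; rewrite -[_ *: _]/(_ * _) mulrAC mulVf// mul1r -[h *: 1]/(h * 1) mulr1 (addrC h).
have cvgP : (h^-1 *: (g (h *: 1 + t) - g t) @[h --> 0^'] --> l) <->
  forall e : R, 0 < e -> exists2 d : R, 0 < d &
    forall h, `|h| < d -> `|g (t + h) - g t - l * h| <= e * `|h|.
  split=> [/cvgrPdist_le H e e0|H].
  - have := H e e0; rewrite nearE /dnbhs /within => /nbhs_ballP[d /= d0 hd].
    exists d => // h hh; have [->|h0] := eqVneq h 0.
      by rewrite addr0 subrr mulr0 subr0 normr0 mulr0.
    have := hd h; rewrite -ball_normE /= sub0r normrN => /(_ hh h0).
    have h0' : 0 < `|h| by rewrite normr_gt0.
    by rewrite -(ler_pM2r h0') -normrM mulrBl eqh// distrC.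
  - apply/cvgrPdist_le => e e0; have [d d0 hd] := H e e0.
    rewrite nearE /dnbhs /within; apply/nbhs_ballP; exists d => // h.
    rewrite -ball_normE /= sub0r normrN => hh h0.
    have h0' : 0 < `|h| by rewrite normr_gt0.
    by rewrite -(ler_pM2r h0') -normrM mulrBl eqh// distrC; exact: hd.
split=> [[dg gl]|/cvgP H].
  by apply/cvgP; rewrite -gl; exact: dg.
split; first by apply/cvg_ex; exists l.
exact: (cvg_lim (@norm_hausdorff _ R)).
Qed.

(** Derivative of a curve in the complex plane; it is computed coordinatewise
    by [rdiffP]. *)
Definition rdiff (R : realType) (g : R -> R[i]) (t : R) (l : R[i]) : Prop :=
  forall e : R, 0 < e -> exists2 d : R, 0 < d &
    forall h : R, `|h| < d -> nrm (g (t + h) - g t - l * h%:C) <= e * `|h|.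

Lemma rdiffP (R : realType) (g : R -> R[i]) (t : R) (l : R[i]) :
  rdiff g t l <-> is_derive t 1 (re \o g) (re l) /\ is_derive t 1 (im \o g) (im l).
Proof.
have reE (h : R) : re (g (t + h) - g t - l * h%:C) =
    (re \o g) (t + h) - (re \o g) t - re l * h.
  by clear; rewrite /=; case: (g (t + h)) => ? ?; case: (g t) => ? ?; case: l => ? ? /=; ring.
have imE (h : R) : im (g (t + h) - g t - l * h%:C) =
    (im \o g) (t + h) - (im \o g) t - im l * h.
  by clear; rewrite /=; case: (g (t + h)) => ? ?; case: (g t) => ? ?; case: l => ? ? /=; ring.
split=> [H|[/is_deriveP H1 /is_deriveP H2] e e0].
  split; apply/is_deriveP => e e0; have [d d0 hd] := H e e0; exists d => // h hh.
    by rewrite -reE; apply: le_trans (ler_Re_nrm _) (hd _ hh).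
  by rewrite -imE; apply: le_trans (ler_Im_nrm _) (hd _ hh).
have e20 : 0 < e / 2 by lra.
have [d1 d10 hd1] := H1 _ e20.
have [d2 d20 hd2] := H2 _ e20.
exists (Num.min d1 d2); first by rewrite lt_min d10.
move=> h; rewrite lt_min => /andP[hh1 hh2].
apply: le_trans (ler_nrm_ReIm _) _; rewrite reE imE.
have := hd1 _ hh1; have := hd2 _ hh2; lra.
Qed.

Definition rcts (R : realType) (g : R -> R[i]) : Prop :=
  forall (t e : R), 0 < e -> exists2 d : R, 0 < d &
    forall h : R, `|h| < d -> nrm (g (t + h) - g t) <= e.

Definition ccts (R : realType) (f : R[i] -> R[i]) : Prop :=
  forall (z : R[i]) (e : R), 0 < e -> exists2 d : R, 0 < d &
    forall h : R[i], nrm h < d -> nrm (f (z + h) - f z) <= e.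

Lemma continuousP_real (R : realType) (g : R -> R) :
  (forall t e : R, 0 < e -> exists2 d : R, 0 < d &
    forall h : R, `|h| < d -> `|g (t + h) - g t| <= e) <-> continuous g.
Proof.
split=> [H t|H t e e0].
  apply/cvgrPdist_le => e e0; have [d d0 hd] := H t e e0.
  rewrite nearE; apply/nbhs_ballP; exists d => // h /= hh.
  by have := hd (h - t); rewrite subrKC (distrC h) (distrC (g h)); exact.
have /cvgrPdist_le /(_ e e0) := H t; rewrite nearE => /nbhs_ballP[d d0 hd].
exists d => // h hh; have := hd (t + h); rewrite -ball_normE /= opprD addNKr normrN distrC; exact.
Qed.

Lemma rcts_re (R : realType) (g : R -> R[i]) : rcts g -> continuous (re \o g).
Proof.
move=> H; apply/continuousP_real => t e e0; have [d d0 hd] := H t e e0.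
exists d => // h hh; apply: le_trans (hd h hh).
by apply: le_trans (ler_Re_nrm _); rewrite /=; case: (g (t + h)); case: (g t).
Qed.

Lemma rcts_im (R : realType) (g : R -> R[i]) : rcts g -> continuous (im \o g).
Proof.
move=> H; apply/continuousP_real => t e e0; have [d d0 hd] := H t e e0.
exists d => // h hh; apply: le_trans (hd h hh).
by apply: le_trans (ler_Im_nrm _); rewrite /=; case: (g (t + h)); case: (g t).
Qed.

Lemma continuous_integrable_itv (R : realType) (g : R -> R) (a b : R) : continuous g ->
  (@lebesgue_measure R).-integrable `[a, b] (EFin \o g).
Proof.
move=> cg; apply: continuous_compact_integrable; first exact: segment_compact.
exact: continuous_subspaceT.
Qed.

(** The difference of the integrals over [0, x] and [x, 0], one of which is
    empty, is a primitive on both sides of 0; near a point t it differs by a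
    constant from the integral over [- n, x] for n > |t|. *)
Lemma continuous_primitive (R : realType) (g : R -> R) : continuous g ->
  exists G : R -> R, forall t : R, is_derive t 1 G (g t).
Proof.
move=> cg; pose I (a b : R) := (\int[lebesgue_measure]_(t in `[a, b]) g t)%R.
have I3 (a b c : R) : a <= b -> b <= c -> I a c - I a b = I b c.
  move=> ab bc; rewrite /I Rintegral_itvB ?bnd_simp//.
    apply: Rintegral_itv_obnd_cbnd.
    apply: (integrableS _ _ _ (continuous_integrable_itv b c cg)) => //.
    by apply: subset_itvr; rewrite bnd_simp.
  exact: continuous_integrable_itv.
exists (fun x => I 0 x - I x 0) => t; apply/is_deriveP => e e0.
pose n := `|t| + 1.
have GE x : `|x| < n -> I 0 x - I x 0 = I (- n) x - I (- n) 0.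
  rewrite ltr_norml => /andP[nx xn]; have n0 : 0 <= n by rewrite /n addr_ge0.
  have [x0|x0|->] := ltgtP x 0.
  - rewrite {1}/I set_itv_ge ?bnd_simp -?ltNge// Rintegral_set0.
    rewrite -(@I3 (- n) x 0) ?(ltW x0) ?(ltW nx)//; ring.
  - rewrite {2}/I set_itv_ge ?bnd_simp -?ltNge// Rintegral_set0.
    by rewrite -(@I3 (- n) 0 x) ?(ltW x0) ?oppr_le0//; ring.
  - by rewrite !subrr.
have tn : t < n by rewrite /n; have := ler_norm t; lra.
have nt : - n < t by rewrite /n; have := ler_norm (- t); rewrite normrN; lra.
have [dG GE'] := continuous_FTC1_closed tn (continuous_integrable_itv (- n) n cg) nt (cg t).
have /is_deriveP/(_ e e0)[d d0 hd] : is_derive t 1 (I (- n)) (g t).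
  by split; [exact: dG | rewrite -derive1E].
exists (Num.min d 1); first by rewrite lt_min d0 ltr01.
move=> h; rewrite lt_min => /andP[hd1 h1].
have tn' : `|t| < n by rewrite /n ltrDl.
have thn : `|t + h| < n by apply: le_lt_trans (ler_normD _ _) _; rewrite /n; lra.
rewrite (GE _ tn') (GE _ thn).
by apply: le_trans (hd _ hd1); rewrite le_eqVlt; apply/orP; left; apply/eqP; congr (`| _ |); ring.
Qed.

(** Newton integral: the increment of a primitive, chosen once and for all.
    Primitives differ by constants, so it is linear in g and additive in the
    bounds, whatever their order. *)
Definition nint (R : realType) (a b : R) (g : R -> R[i]) : R[i] :=
  let G := xget (fun=> 0) [set G : R -> R[i] | forall t, rdiff G t (g t)] in G b - G a.

Lemma rcts_primitive (R : realType) (g : R -> R[i]) : rcts g ->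
  exists G : R -> R[i], forall t, rdiff G t (g t).
Proof.
move=> cg.
have [G1 h1] := continuous_primitive (rcts_re cg).
have [G2 h2] := continuous_primitive (rcts_im cg).
by exists (fun t => G1 t +i* G2 t) => t; apply/rdiffP; split.
Qed.

Lemma rdiff_unique (R : realType) (F G g : R -> R[i]) (a b : R) :
  (forall t, rdiff F t (g t)) -> (forall t, rdiff G t (g t)) ->
  F b - F a = G b - G a.
Proof.
move=> hF hG.
have H1 (x : R) : is_derive x 1 ((re \o F) - (re \o G)) 0.
  have /rdiffP[h1 _] := hF x; have /rdiffP[h2 _] := hG x.
  by rewrite -(subrr (re (g x))); exact: is_deriveB.
have H2 (x : R) : is_derive x 1 ((im \o F) - (im \o G)) 0.
  have /rdiffP[_ h1] := hF x; have /rdiffP[_ h2] := hG x.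
  by rewrite -(subrr (im (g x))); exact: is_deriveB.
have := is_derive_0_is_cst a b H1; have := is_derive_0_is_cst a b H2.
rewrite /= !fctE.
case: (F a) => ? ?; case: (F b) => ? ?; case: (G a) => ? ?; case: (G b) => ? ? /= E1 E2.
by congr (_ +i* _); rewrite /=; lra.
Qed.

Lemma nintE (R : realType) (a b : R) (G g : R -> R[i]) :
  (forall t, rdiff G t (g t)) -> nint a b g = G b - G a.
Proof.
move=> hG; rewrite /nint; case: xgetP => [F _ hF|/(_ G)//].
exact: (rdiff_unique _ _ hF hG).
Qed.

Lemma cdiff_rdiff (R : realType) (f : R[i] -> R[i]) (g : R -> R[i]) (t : R) (l m : R[i]) :
  cdiff f (g t) l -> rdiff g t m -> rdiff (f \o g) t (l * m).
Proof.
move=> hf hg e e0.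
have m0 := nrm_ge0 m; have l0 := nrm_ge0 l.
have e10 : 0 < Num.min 1 (e / (2 * (nrm l + 1))).
  by rewrite lt_min ltr01 divr_gt0//; lra.
have e20 : 0 < e / (2 * (nrm m + 1)) by rewrite divr_gt0//; lra.
have [d1 d10 hd1] := hg _ e10; have [d2 d20 hd2] := hf _ e20.
exists (Num.min d1 (d2 / (nrm m + 1))).
  by rewrite lt_min d10 divr_gt0//; lra.
move=> h; rewrite lt_min ltr_pdivlMr; last by lra.
move=> /andP[hh1 hh2]; set k := g (t + h) - g t.
have k1 : nrm (k - m * h%:C) <= Num.min 1 (e / (2 * (nrm l + 1))) * `|h| := hd1 _ hh1.
have k2 : nrm k <= (nrm m + 1) * `|h|.
  rewrite -[k](subrK (m * h%:C)); apply: le_trans (ler_nrmD _ _) _.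
  rewrite nrmM nrmR mulrDl addrC lerD2l.
  by apply: le_trans k1 _; rewrite ler_wpM2r// ge_min lexx.
have k3 : nrm k < d2 by apply: le_lt_trans k2 _; rewrite mulrC.
have := hd2 _ k3; rewrite /k (subrKC (g t)) -/k /= => k4.
rewrite -[X in nrm X](_ : (f (g (t + h)) - f (g t) - l * k) + l * (k - m * h%:C) = _); last by ring.
apply: le_trans (ler_nrmD _ _) _; rewrite nrmM.
have k5 : e / (2 * (nrm m + 1)) * nrm k <= e / 2 * `|h|.
  apply: le_trans (ler_wpM2l (ltW e20) k2) _.
  by rewrite le_eqVlt; apply/orP; left; apply/eqP; field; lra.
have k6 : nrm (k - m * h%:C) <= e / (2 * (nrm l + 1)) * `|h|.
  by apply: le_trans k1 _; rewrite ler_wpM2r// ge_min lexx orbT.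
have k7 : nrm l * nrm (k - m * h%:C) <= e / 2 * `|h|.
  apply: (@le_trans _ _ ((nrm l + 1) * (e / (2 * (nrm l + 1)) * `|h|))).
    by apply: ler_pM => //; [exact: nrm_ge0|lra].
  by rewrite le_eqVlt; apply/orP; left; apply/eqP; field; lra.
lra.
Qed.

Lemma rdiff_eq (R : realType) (g : R -> R[i]) (t : R) (l m : R[i]) :
  rdiff g t l -> l = m -> rdiff g t m.
Proof. by move=> ? <-. Qed.

Lemma rdiffM (R : realType) (f g : R -> R[i]) (t : R) (l m : R[i]) :
  rdiff f t l -> rdiff g t m -> rdiff (fun s => f s * g s) t (l * g t + f t * m).
Proof.
move=> /rdiffP[f1 f2] /rdiffP[g1 g2]; apply/rdiffP; split.
  rewrite (_ : _ \o _ = (re \o f) * (re \o g) - (im \o f) * (im \o g)); last first.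
    by apply/funext => s; rewrite /= !fctE /=; case: (f s); case: (g s).
  apply: is_derive_eq (is_deriveB (is_deriveM f1 g1) (is_deriveM f2 g2)) _.
  rewrite /= /GRing.scale /=; case: (f t) => ? ?; case: (g t) => ? ?; case: (l) => ? ?;
    case: (m) => ? ? /=; ring.
rewrite (_ : _ \o _ = (re \o f) * (im \o g) + (im \o f) * (re \o g)); last first.
  by apply/funext => s; rewrite /= !fctE /=; case: (f s) => ? ?; case: (g s) => ? ? /=.
apply: is_derive_eq (is_deriveD (is_deriveM f1 g2) (is_deriveM f2 g1)) _.
rewrite /= /GRing.scale /=; case: (f t) => ? ?; case: (g t) => ? ?; case: (l) => ? ?;
  case: (m) => ? ? /=; ring.
Qed.

Lemma rdiffD (R : realType) (f g : R -> R[i]) (t : R) (l m : R[i]) :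
  rdiff f t l -> rdiff g t m -> rdiff (fun s => f s + g s) t (l + m).
Proof.
move=> /rdiffP[f1 f2] /rdiffP[g1 g2]; apply/rdiffP; split.
  rewrite (_ : _ \o _ = (re \o f) + (re \o g)); last first.
    by apply/funext => s; rewrite /= !fctE /=; case: (f s); case: (g s).
  by apply: is_derive_eq; case: (l); case: (m).
rewrite (_ : _ \o _ = (im \o f) + (im \o g)); last first.
  by apply/funext => s; rewrite /= !fctE /=; case: (f s); case: (g s).
by apply: is_derive_eq; case: (l); case: (m).
Qed.

Lemma rdiff_cst (R : realType) (c : R[i]) (t : R) : rdiff (fun=> c) t 0.
Proof.
move=> e e0; exists 1 => // h _.
by rewrite subrr mul0r subr0 Normc.normc0 mulr_ge0// ltW.
Qed.

Lemma rdiffZ (R : realType) (c : R[i]) (g : R -> R[i]) (t : R) (l : R[i]) :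
  rdiff g t l -> rdiff (fun s => c * g s) t (c * l).
Proof.
move=> hg; have := rdiffM (rdiff_cst c t) hg.
by rewrite mul0r add0r.
Qed.

Lemma rdiffB (R : realType) (f g : R -> R[i]) (t : R) (l m : R[i]) :
  rdiff f t l -> rdiff g t m -> rdiff (fun s => f s - g s) t (l - m).
Proof.
move=> hf hg; have := rdiffD hf (rdiffZ (-1) hg).
rewrite mulN1r; congr rdiff; apply/funext => s; by rewrite mulN1r.
Qed.

Lemma rdiff_real (R : realType) (t : R) : rdiff (fun s : R => s%:C) t 1.
Proof.
move=> e e0; exists 1 => // h _.
rewrite (_ : _ - _ = 0) ?Normc.normc0 ?mulr_ge0// ?ltW//.
by rewrite rmorphD; ring.
Qed.

Lemma rdiff_line (R : realType) (z w : R[i]) (t : R) :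
  rdiff (fun s : R => z + w * s%:C) t w.
Proof.
apply: rdiff_eq (rdiffD (rdiff_cst z t) (rdiffZ w (rdiff_real t))) _.
by rewrite add0r mulr1.
Qed.

Lemma rctsP (R : realType) (g : R -> R[i]) :
  rcts g <-> continuous (re \o g) /\ continuous (im \o g).
Proof.
split=> [h|[/continuousP_real h1 /continuousP_real h2] t e e0].
  by split; [exact: rcts_re|exact: rcts_im].
have e20 : 0 < e / 2 by lra.
have [d1 d10 hd1] := h1 t _ e20; have [d2 d20 hd2] := h2 t _ e20.
exists (Num.min d1 d2); first by rewrite lt_min d10.
move=> h; rewrite lt_min => /andP[hh1 hh2].
apply: le_trans (ler_nrm_ReIm _) _.
have := hd1 _ hh1; have := hd2 _ hh2; rewrite /=.
case: (g (t + h)) => ? ?; case: (g t) => ? ? /=; lra.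
Qed.

Lemma rctsM (R : realType) (f g : R -> R[i]) :
  rcts f -> rcts g -> rcts (fun s => f s * g s).
Proof.
move=> /rctsP[f1 f2] /rctsP[g1 g2]; apply/rctsP; split.
  rewrite (_ : _ \o _ = (re \o f) * (re \o g) - (im \o f) * (im \o g)); last first.
    by apply/funext => s; rewrite /= !fctE /=; case: (f s); case: (g s).
  move=> t; apply: continuousB; apply: continuousM; solve [exact: f1|exact: f2|exact: g1|exact: g2].
rewrite (_ : _ \o _ = (re \o f) * (im \o g) + (im \o f) * (re \o g)); last first.
  by apply/funext => s; rewrite /= !fctE /=; case: (f s) => ? ?; case: (g s) => ? ? /=.
move=> t; apply: continuousD; apply: continuousM; solve [exact: f1|exact: f2|exact: g1|exact: g2].
Qed.

Lemma rctsB (R : realType) (f g : R -> R[i]) :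
  rcts f -> rcts g -> rcts (fun s => f s - g s).
Proof.
move=> hf hg t e e0; have e20 : 0 < e / 2 by lra.
have [d1 d10 hd1] := hf t _ e20; have [d2 d20 hd2] := hg t _ e20.
exists (Num.min d1 d2); first by rewrite lt_min d10.
move=> h; rewrite lt_min => /andP[hh1 hh2].
rewrite (_ : _ - _ = (f (t + h) - f t) - (g (t + h) - g t)); last by ring.
apply: le_trans (ler_nrmB _ _) _.
have := hd1 _ hh1; have := hd2 _ hh2; lra.
Qed.

Lemma rdiff_rcts (R : realType) (g dg : R -> R[i]) :
  (forall t, rdiff g t (dg t)) -> rcts g.
Proof.
move=> hg; apply/rctsP; split => t; have /rdiffP[h1 h2] := hg t.
  by apply: differentiable_continuous; apply/derivable1_diffP; exact: ex_derive.
by apply: differentiable_continuous; apply/derivable1_diffP; exact: ex_derive.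
Qed.

Lemma cdiff_ccts (R : realType) (f df : R[i] -> R[i]) :
  (forall z, cdiff f z (df z)) -> ccts f.
Proof.
move=> hf z e e0; have [d d0 hd] := hf z 1 ltr01.
have l0 := nrm_ge0 (df z).
exists (Num.min d (e / (nrm (df z) + 1))); first by rewrite lt_min d0 divr_gt0//; lra.
move=> h; rewrite lt_min ltr_pdivlMr; last by lra.
move=> /andP[/hd h1 h2].
rewrite -(subrK (df z * h) (f (z + h) - f z)).
apply: le_trans (ler_nrmD _ _) _; rewrite nrmM; lra.
Qed.

Lemma ccts_rcts (R : realType) (f : R[i] -> R[i]) (g : R -> R[i]) :
  ccts f -> rcts g -> rcts (f \o g).
Proof.
move=> hf hg t e e0; have [d d0 hd] := hf (g t) e e0.
have d20 : 0 < d / 2 by lra.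
have [d1 d10 hd1] := hg t _ d20; exists d1 => // h /hd1 hh.
have := hd (g (t + h) - g t); rewrite (subrKC (g t)); apply; lra.
Qed.

(** Real and imaginary parts attain their mean values at different points,
    hence the factor 2. *)
Lemma ler_rdiff (R : realType) (g dg : R -> R[i]) (a b M : R) (c : R[i]) :
  (forall t, rdiff g t (dg t)) -> a <= b ->
  (forall t, a <= t <= b -> nrm (dg t - c) <= M) ->
  nrm (g b - g a - c * (b - a)%:C) <= 2 * M * (b - a).
Proof.
move=> hg ab hM.
have [cr ci] := proj1 (rctsP g) (rdiff_rcts hg).
have [s1 s1ab e1] := @MVT_segment R (re \o g) (re \o dg) a b ab
  (fun t _ => proj1 (proj1 (rdiffP _ _ _) (hg t))) (continuous_subspaceT cr).
have [s2 s2ab e2] := @MVT_segment R (im \o g) (im \o dg) a b ab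
  (fun t _ => proj2 (proj1 (rdiffP _ _ _) (hg t))) (continuous_subspaceT ci).
apply: le_trans (ler_nrm_ReIm _) _.
have -> : re (g b - g a - c * (b - a)%:C) = re (dg s1 - c) * (b - a).
  move: e1; clear; rewrite /=; case: (g b) => ? ?; case: (g a) => ? ?; case: c => ? ?;
    case: (dg s1) => ? ? /=; lra.
have -> : im (g b - g a - c * (b - a)%:C) = im (dg s2 - c) * (b - a).
  move: e2; clear; rewrite /=; case: (g b) => ? ?; case: (g a) => ? ?; case: c => ? ?;
    case: (dg s2) => ? ? /=; lra.
rewrite !normrM (ger0_norm (_ : 0 <= b - a)) ?subr_ge0//.
rewrite -mulrDl ler_wpM2r ?subr_ge0//.
have := le_trans (ler_Re_nrm _) (hM _ s1ab).
have := le_trans (ler_Im_nrm _) (hM _ s2ab); lra.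
Qed.

Lemma ler_nint (R : realType) (g : R -> R[i]) (a b M : R) (c : R[i]) :
  rcts g -> a <= b ->
  (forall t, a <= t <= b -> nrm (g t - c) <= M) ->
  nrm (nint a b g - c * (b - a)%:C) <= 2 * M * (b - a).
Proof.
move=> /rcts_primitive[G hG] ab hM.
by rewrite (nintE _ _ hG); exact: ler_rdiff hM.
Qed.

Lemma nint_add (R : realType) (g : R -> R[i]) (a b c : R) : rcts g ->
  nint a b g + nint b c g = nint a c g.
Proof. by move=> /rcts_primitive[G hG]; rewrite !(nintE _ _ hG); ring. Qed.

Lemma nint_opp (R : realType) (g : R -> R[i]) (a b : R) : rcts g ->
  nint b a g = - nint a b g.
Proof. by move=> /rcts_primitive[G hG]; rewrite !(nintE _ _ hG); ring. Qed.

Lemma nintB (R : realType) (f g : R -> R[i]) (a b : R) : rcts f -> rcts g ->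
  nint a b (fun t => f t - g t) = nint a b f - nint a b g.
Proof.
move=> /rcts_primitive[F hF] /rcts_primitive[G hG].
rewrite (nintE _ _ hF) (nintE _ _ hG) (nintE _ _ (fun t => rdiffB (hF t) (hG t))).
by ring.
Qed.

Lemma nintZ (R : realType) (c : R[i]) (g : R -> R[i]) (a b : R) : rcts g ->
  nint a b (fun t => c * g t) = c * nint a b g.
Proof.
move=> /rcts_primitive[G hG].
by rewrite (nintE _ _ hG) (nintE _ _ (fun t => rdiffZ c (hG t))) mulrBr.
Qed.

(** * Bisection and Goursat's theorem *)

Lemma nested_intervals (R : realType) (a b : nat -> R) :
  (forall n, a n <= a n.+1) -> (forall n, b n.+1 <= b n) -> (forall n, a n <= b n) ->
  exists x, forall n, a n <= x <= b n.
Proof.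
move=> ha hb hab.
have am m n : (m <= n)%N -> a m <= a n by exact: (homo_leq (@lexx _ R) (@le_trans _ R)).
have bm m n : (m <= n)%N -> b n <= b m.
  by apply: (homo_leq (@lexx _ R) (fun y x z h1 h2 => le_trans h2 h1)).
have ub n : ubound (range a) (b n).
  move=> _ [k _ <-]; apply: (le_trans (am _ _ (leq_maxl k n))).
  by apply: (le_trans (hab _)); apply: bm; exact: leq_maxr.
exists (sup (range a)) => n; apply/andP; split.
  by apply: ub_le_sup; [exists (b 0%N)|exists n].
by apply: ge_sup; [exists (a 0%N); exists 0%N|exact: ub].
Qed.

Lemma half_powers_lt (R : realType) (w d : R) : 0 < d -> exists n : nat, w / 2 ^+ n < d.
Proof.
move=> d0; exists (Num.truncn (w / d)).+1.
rewrite ltr_pdivrMr ?exprn_gt0//.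
have h1 : w / d < (Num.truncn (w / d)).+1%:R by exact: truncnS_gt.
rewrite ltr_pdivrMr// in h1; apply: lt_le_trans h1 _.
rewrite mulrC ler_wpM2l ?(ltW d0)// -natrX ler_nat.
exact: ltnW (ltn_expl _ _).
Qed.

(** A rectangle without the property has a quarter without it; the nested
    quarters shrink to a point, around which the property holds locally. *)
Lemma bisection2 (R : realType) (P : R -> R -> R -> R -> Prop) :
  (forall a b c d, let m := (a + b) / 2 in let n := (c + d) / 2 in
     a <= b -> c <= d ->
     P a m c n -> P m b c n -> P a m n d -> P m b n d -> P a b c d) ->
  (forall x y, exists2 r : R, 0 < r & forall a b c d, a <= x <= b -> c <= y <= d ->
     b - a < r -> d - c < r -> P a b c d) ->
  forall a b c d, a <= b -> c <= d -> P a b c d.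
Proof.
move=> hsub hloc a0 b0 c0 d0 ab0 cd0; apply: contrapT => nP0.
pose quarter (q q' : R * R * (R * R)) :=
  let: ((a, b), (c, d)) := q in let: ((a', b'), (c', d')) := q' in
  [/\ a <= a', b' <= b, c <= c', d' <= d &
     b' - a' = (b - a) / 2 /\ d' - c' = (d - c) / 2].
pose bad (q : R * R * (R * R)) := let: ((a, b), (c, d)) := q in
  [/\ a <= b, c <= d & ~ P a b c d].
have [nxt hnxt] : {nxt | forall q, bad q -> bad (nxt q) /\ quarter q (nxt q)}.
  suff /choice[nxt hnxt] : forall q, exists q', bad q -> bad q' /\ quarter q q'.
    by exists nxt.
  move=> [[a b] [c d]]; have [[ab cd nP]|nb] := pselect (bad (a, b, (c, d))); last first.
    by exists (a, b, (c, d)).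
  apply: contrapT => /forallNP H; apply: nP; apply: hsub => //; apply: contrapT => nP.
  - apply: (H (a, (a + b) / 2, (c, (c + d) / 2))) => _; split; split => //; try split;
    rewrite ?/quarter; lra.
  - apply: (H ((a + b) / 2, b, (c, (c + d) / 2))) => _; split; split => //; try split;
    rewrite ?/quarter; lra.
  - apply: (H (a, (a + b) / 2, ((c + d) / 2, d))) => _; split; split => //; try split;
    rewrite ?/quarter; lra.
  - apply: (H ((a + b) / 2, b, ((c + d) / 2, d))) => _; split; split => //; try split;
    rewrite ?/quarter; lra.
pose q n := iter n nxt (a0, b0, (c0, d0)).
have hq n : bad (q n) by elim: n => [|n /hnxt[]//]; split.
have hqq n : quarter (q n) (q n.+1) by have [] := hnxt _ (hq n).
pose a n := (q n).1.1; pose b n := (q n).1.2; pose c n := (q n).2.1; pose d n := (q n).2.2.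
have hbad n : [/\ a n <= b n, c n <= d n & ~ P (a n) (b n) (c n) (d n)].
  by have := hq n; rewrite /a /b /c /d; case: (q n) => [[? ?] [? ?]].
have hqt n : [/\ a n <= a n.+1, b n.+1 <= b n, c n <= c n.+1, d n.+1 <= d n &
    b n.+1 - a n.+1 = (b n - a n) / 2 /\ d n.+1 - c n.+1 = (d n - c n) / 2].
  have := hqq n; rewrite /a /b /c /d.
  by case: (q n) => [[? ?] [? ?]]; case: (q n.+1) => [[? ?] [? ?]] [].
have [x hx] : exists x, forall n, a n <= x <= b n.
  by apply: nested_intervals => n; have [] := hqt n => //; have [] := hbad n.
have [y hy] : exists y, forall n, c n <= y <= d n.
  by apply: nested_intervals => n; have [] := hqt n => //; have [] := hbad n.
have wb n : b n - a n = (b0 - a0) / 2 ^+ n.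
  elim: n => [|n ih]; first by rewrite expr0 divr1.
  by have [_ _ _ _ [-> _]] := hqt n; rewrite ih exprSr invfM mulrA.
have wd n : d n - c n = (d0 - c0) / 2 ^+ n.
  elim: n => [|n ih]; first by rewrite expr0 divr1.
  by have [_ _ _ _ [_ ->]] := hqt n; rewrite ih exprSr invfM mulrA.
have [r r0 hr] := hloc x y.
have [n hn] := half_powers_lt ((b0 - a0) + (d0 - c0)) r0.
have [_ _] := hbad n; apply; apply: hr => //.
  rewrite wb; apply: le_lt_trans hn; rewrite ler_wpM2r ?invr_ge0 ?exprn_ge0//; lra.
rewrite wd; apply: le_lt_trans hn; rewrite ler_wpM2r ?invr_ge0 ?exprn_ge0//; lra.
Qed.

Lemma nrm_rect (R : realType) (a b c d x y s t : R) :
  a <= x <= b -> a <= s <= b -> c <= y <= d -> c <= t <= d ->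
  nrm ((s +i* t) - (x +i* y)) <= (b - a) + (d - c).
Proof.
move=> /andP[? ?] /andP[? ?] /andP[? ?] /andP[? ?].
by apply: le_trans (ler_nrm_ReIm _) _; rewrite /=; apply: lerD; rewrite ler_norml; apply/andP;
  split; lra.
Qed.

(** The increment h is free to leave the rectangle that contains z: this is
    what makes the property pass from the four quarters to the whole. *)
Lemma ccts_heine (R : realType) (f : R[i] -> R[i]) (M e : R) : ccts f -> 0 < e ->
  exists2 d : R, 0 < d & forall z h, nrm z <= M -> nrm h < d ->
    nrm (f (z + h) - f z) <= e.
Proof.
move=> hf e0; have [M0|M0] := leP 0 M; last first.
  exists 1 => // z h zM; have := nrm_ge0 z; lra.
pose P a b c d := exists2 r : R, 0 < r & forall x y h,
  a <= x <= b -> c <= y <= d -> nrm h < r ->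
  nrm (f ((x +i* y) + h) - f (x +i* y)) <= e.
have : P (- M) M (- M) M.
  apply: (@bisection2 _ P); try lra.
  - move=> a b c d m n ab cd [r1 r10 h1] [r2 r20 h2] [r3 r30 h3] [r4 r40 h4].
    exists (Num.min (Num.min r1 r2) (Num.min r3 r4)).
      by rewrite !lt_min r10 r20 r30.
    move=> x y h /andP[ax xb] /andP[cy yd]; rewrite !lt_min => /andP[/andP[? ?] /andP[? ?]].
    have [xm|mx] := leP x m; have [yn|ny] := leP y n.
    + by apply: h1 => //; apply/andP.
    + by apply: h3 => //; apply/andP; split => //; exact: ltW.
    + by apply: h2 => //; apply/andP; split => //; exact: ltW.
    + by apply: h4 => //; apply/andP; split => //; exact: ltW.
  - move=> x y; have e20 : 0 < e / 2 by lra.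
    have [d d0 hd] := hf (x +i* y) _ e20.
    exists (d / 4); first lra.
    move=> a b c d' hx hy w1 w2; exists (d / 2); first lra.
    move=> s t h hs ht hh.
    have k1 := nrm_rect hx hs hy ht.
    set k := (s +i* t) - (x +i* y) in k1.
    have -> : s +i* t = (x +i* y) + k by rewrite /k; ring.
    rewrite -addrA -(subrKA (f (x +i* y))).
    apply: le_trans (ler_nrmD _ _) _; rewrite (nrmB (f (x +i* y))).
    have := hd k; have := hd (k + h); have := ler_nrmD k h => *.
    rewrite [e]splitr; apply: lerD; [apply: hd|apply: hd]; lra.
move=> [r r0 hr]; exists r => // -[x y] h hz hh.
by apply: hr => //; rewrite -ler_norml; apply: le_trans hz;
  [exact: (ler_Re_nrm (x +i* y))|exact: (ler_Im_nrm (x +i* y))].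
Qed.

Lemma rdiff_horizontal (R : realType) (y t : R) : rdiff (fun s => s +i* y) t 1.
Proof.
have := rdiff_line (0 +i* y) 1 t; congr rdiff; apply/funext => s.
by simpc.
Qed.

Lemma rdiff_vertical (R : realType) (x t : R) : rdiff (fun s => x +i* s) t 'i%C.
Proof.
have := rdiff_line x%:C 'i%C t; congr rdiff; apply/funext => s.
by simpc.
Qed.

Lemma rcts_horizontal (R : realType) (f : R[i] -> R[i]) (y : R) : ccts f ->
  rcts (fun s => f (s +i* y)).
Proof.
move=> hf; apply: (ccts_rcts (g := fun s => s +i* y)) => //.
by apply: (@rdiff_rcts _ _ (fun=> 1)) => t; exact: rdiff_horizontal.
Qed.

Lemma rcts_vertical (R : realType) (f : R[i] -> R[i]) (x : R) : ccts f ->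
  rcts (fun s => f (x +i* s)).
Proof.
move=> hf; apply: (ccts_rcts (g := fun s => x +i* s)) => //.
by apply: (@rdiff_rcts _ _ (fun=> 'i%C)) => t; exact: rdiff_vertical.
Qed.

(** The integral of f dz along the boundary of [a, b] x [c, d].  Opposite sides
    are grouped under one integral sign, so that an affine f gives constant
    integrands. *)
Definition rect_integral (R : realType) (f : R[i] -> R[i]) (a b c d : R) : R[i] :=
  nint a b (fun x => f (x +i* c) - f (x +i* d)) +
  'i%C * nint c d (fun y => f (b +i* y) - f (a +i* y)).

Lemma rect_integralE (R : realType) (f : R[i] -> R[i]) (a b c d : R) : ccts f ->
  rect_integral f a b c d =
  (nint a b (fun x => f (x +i* c)) - nint a b (fun x => f (x +i* d))) +
  'i%C * (nint c d (fun y => f (b +i* y)) - nint c d (fun y => f (a +i* y))).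
Proof.
move=> hf; rewrite /rect_integral !nintB//.
- exact: rcts_vertical.
- exact: rcts_vertical.
- exact: rcts_horizontal.
- exact: rcts_horizontal.
Qed.

Lemma rect_integral_split (R : realType) (f : R[i] -> R[i]) (a m b c n d : R) : ccts f ->
  rect_integral f a b c d = rect_integral f a m c n + rect_integral f m b c n + rect_integral f a
    m n d + rect_integral f m b n d.
Proof.
move=> hf; rewrite !rect_integralE//.
have h y := nint_add a m b (rcts_horizontal y hf).
have v x := nint_add c n d (rcts_vertical x hf).
rewrite -!h -!v; ring.
Qed.

(** Near a point of differentiability, the affine part of f contributes zero and
    the remainder at most e times the squared half-perimeter.  Halving both sides
    divides the latter by 4, so the bound for four quarters adds up to the bound
    for the rectangle. *)
Lemma goursat (R : realType) (f df : R[i] -> R[i]) : (forall z, cdiff f z (df z)) ->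
  forall a b c d : R, a <= b -> c <= d -> rect_integral f a b c d = 0.
Proof.
move=> hf a b c d ab cd; have cf := cdiff_ccts hf.
suff H e : 0 < e -> nrm (rect_integral f a b c d) <= e * ((b - a) + (d - c)) ^+ 2.
  apply/eqP; rewrite -nrm_eq0 eq_le nrm_ge0 andbT; apply/ler_addgt0Pl => e e0.
  rewrite addr0; set s := _ + _ in H; have s0 : 0 <= s ^+ 2 by exact: sqr_ge0.
  have e'0 : 0 < e / (s ^+ 2 + 1) by rewrite divr_gt0//; lra.
  apply: le_trans (H _ e'0) _; rewrite mulrAC ler_pdivrMr; last by lra.
  rewrite ler_wpM2l ?(ltW e0)//; lra.
move=> e0; move: a b c d ab cd.
apply: (@bisection2 _ (fun a b c d => nrm (rect_integral f a b c d) <= e * ((b - a) + (d - c))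
  ^+ 2)).
- move=> a b c d m n ab cd h1 h2 h3 h4.
  rewrite (rect_integral_split a m b c n d cf).
  apply: le_trans (ler_nrmD _ _) _; apply: le_trans (lerD (ler_nrmD _ _) (lexx _)) _.
  apply: le_trans (lerD (lerD (ler_nrmD _ _) (lexx _)) (lexx _)) _.
  apply: le_trans (lerD (lerD (lerD h1 h2) h3) h4) _.
  by rewrite le_eqVlt; apply/orP; left; apply/eqP; rewrite /m /n; field.
- move=> x y; have e40 : 0 < e / 4 by lra.
  have [r r0 hr] := hf (x +i* y) _ e40; exists (r / 2); first lra.
  move=> a b c d hx hy w1 w2; set s := (b - a) + (d - c).
  have ab : a <= b by case/andP: hx => *; lra.
  have cd : c <= d by case/andP: hy => *; lra.
  have rem u v : a <= u <= b -> c <= v <= d ->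
      nrm (f (u +i* v) - f (x +i* y) - df (x +i* y) * ((u +i* v) - (x +i* y))) <= e / 4 * s.
    move=> hu hv; have k1 := nrm_rect hx hu hy hv.
    have := hr ((u +i* v) - (x +i* y)); rewrite subrKC => h1.
    apply: le_trans (h1 _) _; first by lra.
    by rewrite ler_wpM2l// ltW.
  have haa : a <= a <= b by rewrite lexx.
  have hbb : a <= b <= b by rewrite lexx ab.
  have hcc : c <= c <= d by rewrite lexx.
  have hdd : c <= d <= d by rewrite lexx cd.
  have H1 : nrm (nint a b (fun x => f (x +i* c) - f (x +i* d)) -
      - ('i%C * df (x +i* y) * (d - c)%:C) * (b - a)%:C) <= 2 * (e / 4 * s + e / 4 * s) * (b - a).
    apply: ler_nint => //; first by apply: rctsB; exact: rcts_horizontal.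
    move=> t ht; apply: le_trans (lerD (rem t c ht hcc) (rem t d ht hdd)).
    apply: le_trans (ler_nrmB _ _); rewrite le_eqVlt; apply/orP; left; apply/eqP; congr nrm.
    have -> : t +i* c = t%:C + 'i%C * c%:C by simpc.
    have -> : t +i* d = t%:C + 'i%C * d%:C by simpc.
    rewrite rmorphB; ring.
  have H2 : nrm (nint c d (fun y => f (b +i* y) - f (a +i* y)) -
      (df (x +i* y) * (b - a)%:C) * (d - c)%:C) <= 2 * (e / 4 * s + e / 4 * s) * (d - c).
    apply: ler_nint => //; first by apply: rctsB; exact: rcts_vertical.
    move=> t ht; apply: le_trans (lerD (rem b t hbb ht) (rem a t haa ht)).
    apply: le_trans (ler_nrmB _ _); rewrite le_eqVlt; apply/orP; left; apply/eqP; congr nrm.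
    have -> : b +i* t = b%:C + 'i%C * t%:C by simpc.
    have -> : a +i* t = a%:C + 'i%C * t%:C by simpc.
    rewrite rmorphB; ring.
  have ni : nrm ('i%C : R[i]) = 1 by rewrite nrmE expr0n expr1n /= add0r sqrtr1.
  have -> : e * s ^+ 2 = 2 * (e / 4 * s + e / 4 * s) * (b - a) + 2 * (e / 4 * s + e / 4 * s) * (d
    - c).
    by rewrite /s; field.
  have H3 := ler_wpM2l (nrm_ge0 ('i%C : R[i])) H2; rewrite -nrmM ni mul1r in H3.
  apply: le_trans (lerD H1 H3); apply: le_trans (ler_nrmD _ _).
  (* the affine parts of the two pairs of sides cancel *)
  by rewrite /rect_integral le_eqVlt; apply/orP; left; apply/eqP; congr nrm; ring.
Qed.

Lemma goursat_oriented (R : realType) (f df : R[i] -> R[i]) : (forall z, cdiff f z (df z)) ->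
  forall a b c d : R, rect_integral f a b c d = 0.
Proof.
move=> hf a b c d; have cf := cdiff_ccts hf.
have hx u v p q : rect_integral f v u p q = - rect_integral f u v p q.
  by rewrite !rect_integralE// !(fun y => nint_opp u v (rcts_horizontal y cf)); ring.
have hy u v p q : rect_integral f u v q p = - rect_integral f u v p q.
  by rewrite !rect_integralE// !(fun y => nint_opp p q (rcts_vertical y cf)); ring.
have [ab|/ltW ab] := leP a b; have [cd|/ltW cd] := leP c d.
- exact: goursat hf _ _ _ _ ab cd.
- by rewrite hy (goursat hf ab cd) oppr0.
- by rewrite hx (goursat hf ab cd) oppr0.
- by rewrite hx hy (goursat hf ab cd) !oppr0.
Qed.

(** * Derivatives of entire functions are entire *)

Lemma ler_rdiff_signed (R : realType) (g dg : R -> R[i]) (a b M : R) (c : R[i]) :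
  (forall t, rdiff g t (dg t)) ->
  (forall t, `|t - a| <= `|b - a| -> nrm (dg t - c) <= M) ->
  nrm (g b - g a - c * (b - a)%:C) <= 2 * M * `|b - a|.
Proof.
move=> hg hM; have [ab|/ltW ba] := leP a b.
  rewrite (ger0_norm (_ : 0 <= b - a)) ?subr_ge0//; apply: ler_rdiff hg ab _ => t /andP[at_ tb].
  have h := ler_norm (b - a); apply: hM; rewrite ler_norml; apply/andP; split; lra.
rewrite distrC (ger0_norm (_ : 0 <= a - b)) ?subr_ge0// -nrmN.
rewrite (_ : - _ = g a - g b - c * (a - b)%:C); last by rewrite !rmorphB; ring.
apply: ler_rdiff hg ba _ => t /andP[bt ta].
have h := ler_norm (a - b); rewrite distrC in h; apply: hM; rewrite ler_norml; apply/andP; split;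
  lra.
Qed.

(** Reach z + h from z by a horizontal and then a vertical segment: by
    continuity of g, the slope is close to g z along both. *)
Lemma partials_cdiff (R : realType) (F g : R[i] -> R[i]) :
  (forall x y, rdiff (fun t => F (t +i* y)) x (g (x +i* y))) ->
  (forall x y, rdiff (fun t => F (x +i* t)) y ('i%C * g (x +i* y))) ->
  ccts g -> forall z, cdiff F z (g z).
Proof.
move=> Fx Fy cg [x y] e e0; have e40 : 0 < e / 4 by lra.
have [d d0 hd] := cg (x +i* y) _ e40.
exists (d / 2); first lra.
move=> [p q] hpq.
have hp : `|p| <= nrm (p +i* q) := ler_Re_nrm (p +i* q).
have hq : `|q| <= nrm (p +i* q) := ler_Im_nrm (p +i* q).
have Ep : x + p - x = p by ring.
have Eq : y + q - y = q by ring.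
have H1 : nrm (F ((x + p) +i* y) - F (x +i* y) - g (x +i* y) * (x + p - x)%:C)
    <= 2 * (e / 4) * `|x + p - x|.
  apply: (@ler_rdiff_signed _ (fun t => F (t +i* y)) (fun t => g (t +i* y))) => [t|t];
    first exact: Fx.
  rewrite addrAC subrr add0r => ht.
  have := hd ((t - x)%:C); rewrite nrmR (_ : (x +i* y) + _ = t +i* y); last by simpc;
    rewrite subrKC.
  apply; lra.
have H2 : nrm (F ((x + p) +i* (y + q)) - F ((x + p) +i* y) - ('i%C * g (x +i* y)) * (y + q - y)%:C)
    <= 2 * (e / 4) * `|y + q - y|.
  apply: (@ler_rdiff_signed _ (fun t => F ((x + p) +i* t)) (fun t => 'i%C * g ((x + p) +i* t)))
    => [t|t]; first exact: Fy.
  rewrite addrAC subrr add0r => ht; rewrite -mulrBr nrmM.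
  have -> : nrm ('i%C : R[i]) = 1 by rewrite nrmE expr0n expr1n /= add0r sqrtr1.
  rewrite mul1r.
  have := hd (p +i* (t - y)); rewrite (_ : (x +i* y) + _ = (x + p) +i* t); last by simpc;
    rewrite subrKC.
  by apply; apply: le_lt_trans (ler_nrm_ReIm _) _; rewrite /=; lra.
have E : F ((x +i* y) + (p +i* q)) - F (x +i* y) - g (x +i* y) * (p +i* q) =
   (F ((x + p) +i* y) - F (x +i* y) - g (x +i* y) * (x + p - x)%:C) +
   (F ((x + p) +i* (y + q)) - F ((x + p) +i* y) - ('i%C * g (x +i* y)) * (y + q - y)%:C).
  rewrite Ep Eq.
  rewrite -[(x +i* y) + (p +i* q)]/((x + p) +i* (y + q)).
  have -> : p +i* q = p%:C + 'i%C * q%:C by simpc.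
  ring.
rewrite E; apply: le_trans (ler_nrmD _ _) _.
rewrite Ep in H1 *; rewrite Eq in H2 *.
apply: le_trans (lerD H1 H2) _.
rewrite -mulrDr; have : `|p| + `|q| <= 2 * nrm (p +i* q) by lra.
move=> /(ler_wpM2l (ltW e0)); lra.
Qed.

Lemma nint_rdiff (R : realType) (g : R -> R[i]) (a x : R) : rcts g ->
  rdiff (fun t => nint a t g) x (g x).
Proof.
move=> /rcts_primitive[G hG].
rewrite (_ : (fun t => _) = fun t => G t - G a); last by apply/funext => t; exact: nintE.
by apply: rdiff_eq (rdiffB (hG x) (rdiff_cst _ _)) _; rewrite subr0.
Qed.

(** F integrates f along an L-shaped path from 0; by Goursat's theorem the other
    L-shaped path gives the same value.  The last leg of one path is vertical and
    that of the other horizontal, which gives the two partial derivatives. *)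
Lemma cdiff_primitive (R : realType) (f df : R[i] -> R[i]) : (forall z, cdiff f z (df z)) ->
  exists F, forall z, cdiff F z (f z).
Proof.
move=> hf; have cf := cdiff_ccts hf.
pose F (z : R[i]) := nint 0 (re z) (fun t => f (t +i* 0)) +
  'i%C * nint 0 (im z) (fun s => f (re z +i* s)).
have FE z : F z = nint 0 (re z) (fun t => f (t +i* im z)) +
  'i%C * nint 0 (im z) (fun s => f (0 +i* s)).
  apply/eqP; rewrite -subr_eq0; apply/eqP.
  by rewrite -[RHS](goursat_oriented hf 0 (re z) 0 (im z)) rect_integralE// /F; ring.
exists F; apply: partials_cdiff => //.
- move=> x y; rewrite (_ : (fun t => _) = fun t => nint 0 t (fun t => f (t +i* y)) +
  'i%C * nint 0 y (fun s => f (0 +i* s))); last by apply/funext => t; rewrite FE.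
  apply: rdiff_eq (rdiffD (nint_rdiff 0 x (rcts_horizontal y cf)) (rdiff_cst _ _)) _.
  by rewrite addr0.
- move=> x y; apply: rdiff_eq (rdiffD (rdiff_cst _ _) (rdiffZ _ (nint_rdiff 0 y (rcts_vertical x
  cf)))) _.
  by rewrite add0r.
Qed.

(** Differentiation under the integral sign, for a derivative that is uniformly
    continuous in the parameter. *)
Lemma rdiff_nint (R : realType) (Phi Psi : R -> R -> R[i]) (a b s0 : R) : a <= b ->
  (forall s t, rdiff (Phi ^~ t) s (Psi s t)) ->
  (forall s, rcts (Phi s)) -> rcts (Psi s0) ->
  (forall e : R, 0 < e -> exists2 d : R, 0 < d & forall h t, `|h| < d -> a <= t <= b ->
    nrm (Psi (s0 + h) t - Psi s0 t) <= e) ->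
  rdiff (fun s => nint a b (Phi s)) s0 (nint a b (Psi s0)).
Proof.
move=> ab hPhi cPhi cPsi unif e e0.
have M0 : 0 < e / (4 * (b - a) + 4) by rewrite divr_gt0//; lra.
have [d d0 hd] := unif _ M0; exists d => // h hh.
rewrite mulrC -nintZ// -!nintB//; last 2 first.
- by apply: rctsB.
- by apply: rctsM => //; apply: (@rdiff_rcts _ _ (fun=> 0)) => t; exact: rdiff_cst.
rewrite -[X in nrm X]subr0 -[X in _ - X](mul0r (b - a)%:C).
apply: (@le_trans _ _ (2 * (2 * (e / (4 * (b - a) + 4)) * `|h|) * (b - a))).
  apply: ler_nint => //.
    apply: rctsB; first exact: rctsB.
    by apply: rctsM => //; apply: (@rdiff_rcts _ _ (fun=> 0)) => t; exact: rdiff_cst.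
  move=> t ht; rewrite subr0 mulrC.
  have := @ler_rdiff_signed _ (Phi ^~ t) (Psi ^~ t) s0 (s0 + h) (e / (4 * (b - a) + 4)) (Psi s0 t).
  rewrite addrAC subrr add0r; apply => [s|s hs]; first exact: hPhi.
  by have := hd (s - s0) t; rewrite subrKC; apply => //; exact: le_lt_trans hs hh.
rewrite [leLHS](_ : _ = e * `|h| * ((b - a) / (b - a + 1))); last by field; apply/andP; split; lra.
rewrite ler_piMr// ?mulr_ge0 ?(ltW e0)//.
rewrite ler_pdivrMr; lra.
Qed.

Lemma rcts_cst (R : realType) (c : R[i]) : rcts (fun _ : R => c).
Proof. by apply: (@rdiff_rcts _ _ (fun=> 0)) => t; exact: rdiff_cst. Qed.

Lemma rctsD (R : realType) (f g : R -> R[i]) :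
  rcts f -> rcts g -> rcts (fun s => f s + g s).
Proof.
move=> hf hg; have := rctsB hf (rctsM (rcts_cst (-1)) hg); congr rcts.
by apply/funext => s; rewrite mulN1r opprK.
Qed.

Lemma nrm1 (R : realType) : nrm (1 : R[i]) = 1.
Proof. exact: Normc.normc1. Qed.

Lemma nrm1_le (R : realType) : nrm (1 : R[i]) <= 1.
Proof. by rewrite nrm1. Qed.

Lemma nrmi (R : realType) : nrm ('i%C : R[i]) = 1.
Proof. by rewrite nrmE expr0n expr1n /= add0r sqrtr1. Qed.

(** The affine dependence on the parameter covers both a circle of varying
    radius (w = cis) and a circle whose centre moves (w = 1 or w = i). *)
Lemma rdiff_nint_affine (R : realType) (F f : R[i] -> R[i]) (p w k : R -> R[i])
    (a b s0 B : R) : a <= b -> (forall z, cdiff F z (f z)) -> ccts f ->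
  rcts p -> rcts w -> rcts k ->
  (forall t, nrm (p t) <= B) -> (forall t, nrm (w t) <= 1) -> (forall t, nrm (k t) <= 1) ->
  rdiff (fun s => nint a b (fun t => F (p t + w t * s%:C) * k t)) s0
    (nint a b (fun t => f (p t + w t * s0%:C) * (w t * k t))).
Proof.
move=> ab hF cf cp cw ck hp hw hk; have cF := cdiff_ccts hF.
have cg s : rcts (fun t => p t + w t * s%:C).
  by apply: rctsD => //; apply: rctsM => //; exact: rcts_cst.
apply: (@rdiff_nint _ (fun s t => F (p t + w t * s%:C) * k t)
  (fun s t => f (p t + w t * s%:C) * (w t * k t))) => //.
- move=> s t; have := cdiff_rdiff (hF _) (rdiff_line (p t) (w t) s).
  move=> /rdiffM /(_ (rdiff_cst (k t) s)) h; apply: rdiff_eq h _; ring.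
- by move=> s; apply: rctsM => //; exact: (ccts_rcts cF (cg s)).
- by apply: rctsM; [exact: (ccts_rcts cf (cg s0))|exact: rctsM].
- move=> e e0; have [d d0 hd] := ccts_heine (B + `|s0|) cf e0.
  exists d => // h t hh _; rewrite -mulrBl nrmM nrmM.
  have pw : nrm (w t) * nrm (k t) <= 1 by rewrite mulr_ile1// nrm_ge0.
  apply: (@le_trans _ _ (e * 1)); last by rewrite mulr1.
  apply: ler_pM => //; [exact: nrm_ge0|by rewrite mulr_ge0// nrm_ge0|].
  have -> : p t + w t * (s0 + h)%:C = p t + w t * s0%:C + w t * h%:C.
    by rewrite rmorphD; ring.
  apply: hd.
    apply: le_trans (ler_nrmD _ _) _; apply: lerD => //.
    by rewrite nrmM nrmR ler_piMl.
  by rewrite nrmM nrmR; apply: le_lt_trans hh; rewrite ler_piMl.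
Qed.

Definition cis (R : realType) (t : R) : R[i] := cos t +i* sin t.

Lemma rdiff_cis (R : realType) (t : R) : rdiff (@cis R) t ('i%C * cis t).
Proof.
apply/rdiffP; rewrite /comp /cis /=; split.
  by apply: is_derive_eq (is_derive_cos t) _; ring.
by apply: is_derive_eq (is_derive_sin t) _; ring.
Qed.

Lemma rcts_cis (R : realType) : rcts (@cis R).
Proof. by apply: (@rdiff_rcts _ _ _) => t; exact: rdiff_cis. Qed.

Lemma nrm_cis (R : realType) (t : R) : nrm (cis t) = 1.
Proof. by rewrite nrmE cos2Dsin2 sqrtr1. Qed.

Definition cisN (R : realType) (t : R) : R[i] := cos t -i* sin t.

Lemma cisK (R : realType) (t : R) : cis t * cisN t = 1.
Proof.
rewrite /cis /cisN; simpc; congr (_ +i* _); last by ring.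
by rewrite -(cos2Dsin2 t); ring.
Qed.

Lemma rdiff_cisN (R : realType) (t : R) : rdiff (@cisN R) t (- 'i%C * cisN t).
Proof.
apply/rdiffP; rewrite /comp /cisN /=; split.
  by apply: is_derive_eq (is_derive_cos t) _; ring.
by apply: is_derive_eq (is_deriveN (is_derive_sin t)) _; ring.
Qed.

Lemma rcts_cisN (R : realType) : rcts (@cisN R).
Proof. by apply: (@rdiff_rcts _ _ _) => t; exact: rdiff_cisN. Qed.

Lemma nrm_cisN (R : realType) (t : R) : nrm (cisN t) = 1.
Proof. by rewrite nrmE sqrrN cos2Dsin2 sqrtr1. Qed.

Lemma nrm_cisN_le (R : realType) (t : R) : nrm (cisN t) <= 1.
Proof. by rewrite nrm_cisN. Qed.

Lemma cis2pi (R : realType) : @cis R (pi *+ 2) = @cis R 0.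
Proof. by rewrite /cis cos2pi sin2pi cos0 sin0. Qed.

Lemma cisN2pi (R : realType) : @cisN R (pi *+ 2) = @cisN R 0.
Proof. by rewrite /cisN cos2pi sin2pi cos0 sin0. Qed.

Lemma pi2_ge0 (R : realType) : 0 <= (pi : R) *+ 2.
Proof. by rewrite mulrn_wge0// pi_ge0. Qed.

(** Up to a factor i s, the derivative in the radius s of the circular mean is
    the integral over a period of the derivative in t of F (z + s exp (i t)),
    which is zero. *)
Lemma mean_value (R : realType) (F f : R[i] -> R[i]) (z : R[i]) :
  (forall z, cdiff F z (f z)) -> ccts f ->
  nint 0 (pi *+ 2) (fun t => F (z + cis t)) = F z * ((pi : R) *+ 2)%:C.
Proof.
move=> hF cf; have cF := cdiff_ccts hF.
pose M (s : R) := nint 0 (pi *+ 2) (fun t => F (z + cis t * s%:C) * 1).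
have ccirc (s : R) : rcts (fun t => z + cis t * s%:C).
  apply: rctsD; [exact: rcts_cst|apply: rctsM; [exact: rcts_cis|exact: rcts_cst]].
have hM s : rdiff M s 0.
  apply: rdiff_eq (@rdiff_nint_affine _ F f (fun=> z) (@cis R) (fun=> 1) 0 (pi *+ 2) s (nrm z) _
    hF cf _ _ _ _ _ _) _ => //.
  - exact: pi2_ge0.
  - exact: rcts_cst.
  - exact: rcts_cis.
  - exact: rcts_cst.
  - by move=> t; rewrite nrm_cis.
  - by move=> t; rewrite nrm1.
  have [->|s0] := eqVneq s 0.
    under [X in nint _ _ X]eq_fun do rewrite mulr0 addr0 mulr1.
    rewrite (@nintE _ _ _ (fun t => f z * (- 'i%C) * cis t)).
      by rewrite cis2pi subrr.
    move=> t; apply: rdiff_eq (rdiffZ _ (rdiff_cis t)) _.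
    by rewrite mulrA -(mulrA (f z)) mulNr -expr2 sqr_i opprK mulr1.
  apply: (@mulfI _ (s%:C * 'i%C)).
    by rewrite mulf_eq0 -!nrm_eq0 nrmR nrmi normr_eq0 oner_eq0 orbF.
  rewrite mulr0 -nintZ; last first.
    apply: rctsM; first exact: (ccts_rcts cf (ccirc s)).
    by apply: rctsM; [exact: rcts_cis|exact: rcts_cst].
  rewrite (@nintE _ _ _ (fun t => F (z + cis t * s%:C))); first by rewrite cis2pi subrr.
  move=> t; apply: rdiff_eq (cdiff_rdiff (hF _) (rdiffD (rdiff_cst z t) (rdiffM (rdiff_cis t)
    (rdiff_cst s%:C t)))) _.
  ring.
have := rdiff_unique 0 1 hM (rdiff_cst 0); rewrite subrr => /eqP.
rewrite subr_eq0 => /eqP M1.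
have -> : nint 0 (pi *+ 2) (fun t : R => F (z + cis t)) = M 1.
  by congr nint; apply/funext => t; rewrite !mulr1.
rewrite M1 /M; under [X in nint _ _ X]eq_fun do rewrite mulr0 addr0 mulr1.
rewrite (@nintE _ _ _ (fun t => 0 + F z * t%:C)); first by rewrite mulr0; ring.
by move=> t; exact: rdiff_line.
Qed.

Lemma rdiff_lim_unique (R : realType) (g : R -> R[i]) (t : R) (l m : R[i]) :
  rdiff g t l -> rdiff g t m -> l = m.
Proof.
move=> /rdiffP[[_ l1] [_ l2]] /rdiffP[[_ m1] [_ m2]].
by move: l1 l2 m1 m2; case: l => ? ?; case: m => ? ? /= <- <- <- <-.
Qed.

Lemma rcts_circle (R : realType) (z : R[i]) : rcts (fun t => z + @cis R t).
Proof. by apply: rctsD; [exact: rcts_cst|exact: rcts_cis]. Qed.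

Lemma nrm_circle (R : realType) (z : R[i]) (t : R) : nrm (z + @cis R t) <= nrm z + 1.
Proof. by apply: le_trans (ler_nrmD _ _) _; rewrite nrm_cis. Qed.

(** Differentiating the mean value property in z shows that f z is a circular
    mean of f, and an integration by parts in the angle expresses it through F
    alone.  Thus the derivative f of F is written in terms of F. *)
Lemma cauchy_integral_deriv (R : realType) (F f : R[i] -> R[i]) (z : R[i]) :
  (forall z, cdiff F z (f z)) -> ccts f ->
  nint 0 (pi *+ 2) (fun t => F (z + cis t) * cisN t) = f z * ((pi : R) *+ 2)%:C.
Proof.
move=> hF cf; have cF := cdiff_ccts hF.
transitivity (nint 0 (pi *+ 2) (fun t : R => f (z + cis t))).
  apply: (@mulfI _ 'i%C); first by rewrite eq_complex/= oner_eq0 andbF.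
  apply/eqP; rewrite eq_sym -subr_eq0; apply/eqP.
  rewrite -!nintZ -?nintB.
  - rewrite (@nintE _ _ _ (fun t => F (z + cis t) * cisN t)).
      by rewrite cis2pi cisN2pi subrr.
    move=> t.
    apply: rdiff_eq (rdiffM (cdiff_rdiff (hF _) (rdiffD (rdiff_cst z t) (rdiff_cis t)))
      (rdiff_cisN t)) _.
    rewrite -[X in _ = 'i%C * X - _]mulr1 -(cisK t) /comp; ring.
  - exact: (rctsM (rcts_cst _) (ccts_rcts cf (rcts_circle z))).
  - exact: (rctsM (rcts_cst _) (rctsM (ccts_rcts cF (rcts_circle z)) (@rcts_cisN R))).
  - exact: (rctsM (ccts_rcts cF (rcts_circle z)) (@rcts_cisN R)).
  - exact: (ccts_rcts cf (rcts_circle z)).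
have H1 := @rdiff_nint_affine _ F f (fun t => z + cis t) (fun=> 1) (fun=> 1) 0 (pi *+ 2) 0 (nrm z
  + 1)
  (pi2_ge0 R) hF cf (rcts_circle z) (rcts_cst 1) (rcts_cst 1) (nrm_circle z)
  (fun=> nrm1_le R) (fun=> nrm1_le R).
have E (s : R) : nint 0 (pi *+ 2) (fun t => F (z + cis t + 1 * s%:C) * 1) =
    F (z + 1 * s%:C) * ((pi : R) *+ 2)%:C.
  rewrite -(mean_value _ hF cf); congr nint; apply/funext => t.
  by rewrite mulr1; congr F; ring.
move: H1; rewrite (_ : (fun s : R => _) = fun s => F (z + 1 * s%:C) * ((pi : R) *+ 2)%:C);
  last by apply/funext.
move=> H1.
have H2 := rdiffM (cdiff_rdiff (hF _) (rdiff_line z 1 0)) (rdiff_cst ((pi : R) *+ 2)%:C 0).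
rewrite (_ : f z * _ = f (z + 1 * 0%:C) * 1 * ((pi : R) *+ 2)%:C + (F \o (fun s => z + 1 * s%:C))
  0 * 0); last first.
  by rewrite !mulr0 !addr0 mulr1.
rewrite -(rdiff_lim_unique H1 H2); congr nint; apply/funext => t.
by rewrite !mulr1 mulr0 addr0.
Qed.

Lemma horizontal_shift (R : realType) (x y s : R) : (x +i* y) + 1 * s%:C = (x + s) +i* y.
Proof. by rewrite mul1r -[LHS]/((x + s) +i* (y + 0)) addr0. Qed.

Lemma vertical_shift (R : realType) (x y s : R) : (x +i* y) + 'i%C * s%:C = x +i* (y + s).
Proof. by simpc. Qed.

Lemma cdiffZ (R : realType) (c : R[i]) (f : R[i] -> R[i]) (z l : R[i]) :
  cdiff f z l -> cdiff (fun z => c * f z) z (c * l).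
Proof.
move=> hf e e0; have c0 := nrm_ge0 c.
have e'0 : 0 < e / (nrm c + 1) by rewrite divr_gt0//; lra.
have [d d0 hd] := hf _ e'0; exists d => // h /hd hh.
rewrite -mulrA -!mulrBr nrmM; apply: le_trans (ler_wpM2l c0 hh) _.
rewrite mulrA ler_wpM2r ?nrm_ge0// mulrCA ler_piMr ?(ltW e0)//.
rewrite ler_pdivrMr; lra.
Qed.

(** In the integral formula for f = F', differentiation in z acts on F under the
    integral sign and produces the same integral for f, which is continuous. *)
Lemma cdiff_of_continuous_derivative (R : realType) (F f : R[i] -> R[i]) :
  (forall z, cdiff F z (f z)) -> ccts f ->
  exists2 g, (forall z, cdiff f z (g z)) & ccts g.
Proof.
move=> hF cf; have cF := cdiff_ccts hF.
pose K (z : R[i]) := nint 0 (pi *+ 2) (fun t => F (z + cis t) * cisN t).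
pose G (z : R[i]) := nint 0 (pi *+ 2) (fun t => f (z + cis t) * cisN t).
have rG z : rcts (fun t => f (z + cis t) * cisN t).
  exact: (rctsM (ccts_rcts cf (rcts_circle z)) (@rcts_cisN R)).
have cG : ccts G.
  move=> z e e0; have pi0 := pi2_ge0 R.
  have e'0 : 0 < e / (2 * (pi *+ 2 + 1)) by rewrite divr_gt0//; lra.
  have [d d0 hd] := ccts_heine (nrm z + 1) cf e'0.
  exists d => // h hh; rewrite /G -nintB//.
  rewrite -[X in nrm X]subr0 -[X in _ - X](mul0r (pi *+ 2 - 0)%:C).
  apply: le_trans (ler_nint (M := e / (2 * (pi *+ 2 + 1))) _ _ _) _ => //.
  - exact: rctsB.
  - move=> t _; rewrite subr0 -mulrBl nrmM nrm_cisN mulr1 addrAC.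
    by apply: hd => //; exact: nrm_circle.
  rewrite subr0 (_ : _ * _ = e * (pi *+ 2 / (pi *+ 2 + 1))); last by field; lra.
  by rewrite ler_piMr ?(ltW e0)// ler_pdivrMr; lra.
have dK z w : nrm w <= 1 -> rdiff (fun s => K (z + w * s%:C)) 0 (w * G z).
  move=> hw.
  have := @rdiff_nint_affine _ F f (fun t => z + cis t) (fun=> w) (@cisN R) 0 (pi *+ 2) 0 (nrm z
    + 1)
    (pi2_ge0 R) hF cf (rcts_circle z) (rcts_cst w) (@rcts_cisN R) (nrm_circle z)
    (fun=> hw) (@nrm_cisN_le R).
  rewrite (_ : (fun s => _) = (fun s => K (z + w * s%:C))).
    move=> h; apply: rdiff_eq h _; rewrite /G -nintZ//; congr nint; apply/funext => t.
    by rewrite mulr0 addr0; ring.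
  apply/funext => s; congr nint; apply/funext => t; congr (F _ * _); ring.
have shift (g : R -> R[i]) (x : R) l : rdiff (fun s => g (x + s)) 0 l -> rdiff g x l.
  move=> hg e e0; have [d d0 hd] := hg e e0; exists d => // h hh.
  by have := hd h hh; rewrite add0r addr0.
have hK z : cdiff K z (G z).
  apply: partials_cdiff => // x y; apply: shift.
    rewrite (_ : (fun s : R => _) = fun s => K ((x +i* y) + 1 * s%:C)).
      by have := dK (x +i* y) 1 (nrm1_le R); rewrite mul1r.
    by apply/funext => s; rewrite horizontal_shift.
  rewrite (_ : (fun s : R => _) = fun s => K ((x +i* y) + 'i%C * s%:C)).
    by apply: dK; rewrite nrmi.
  by apply/funext => s; rewrite vertical_shift.
pose c : R[i] := ((pi *+ 2)^-1)%:C.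
have c1 : c * ((pi : R) *+ 2)%:C = 1.
  by rewrite -rmorphM mulVf// mulrn_eq0/= gt_eqF// pi_gt0.
have -> : f = fun z => c * K z.
  by apply/funext => z; rewrite /K (cauchy_integral_deriv _ hF cf) mulrCA c1 mulr1.
exists (fun z => c * G z) => [z|]; first exact: cdiffZ.
move=> z e e0; have c0 := nrm_ge0 c.
have e'0 : 0 < e / (nrm c + 1) by rewrite divr_gt0//; lra.
have [d d0 hd] := cG z _ e'0; exists d => // h /hd hh.
rewrite -mulrBr nrmM; apply: le_trans (ler_wpM2l c0 hh) _.
by rewrite mulrCA ler_piMr ?(ltW e0)// ler_pdivrMr; lra.
Qed.

(** The regularity step is used twice: from a primitive F it makes f'
    continuous, and from f it then makes f' differentiable. *)
Lemma entire_cderive (R : realType) (f : R[i] -> R[i]) : entire f -> entire (cderive f).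
Proof.
move=> /entire_cdiff hf.
have [F hF] := cdiff_primitive hf.
have [g hg cg] := cdiff_of_continuous_derivative hF (cdiff_ccts hf).
have [h hh _] := cdiff_of_continuous_derivative hg cg.
have [_ ->] := cdiff_entire hg.
by have [] := cdiff_entire hh.
Qed.

(** * Integration over the plane *)

Lemma area_setX (R : realType) (A B : set (measurableTypeR R)) : measurable A -> measurable B ->
  (area R (A `*` B) = @lebesgue_measure R A * @lebesgue_measure R B)%E.
Proof. exact: product_measure1E. Qed.

(** An open set is the union of the countably many balls with rational centre
    and radius that it contains, and balls for the sup distance are squares. *)
Lemma open_measurable_plane (R : realType) (O : set (R * R)) : open O ->
  measurable (O : set (plane R)).
Proof.
move=> oO.
pose F (q : rat * rat * rat) : set (plane R) :=
  if `[< ball (ratr q.1.1 : R, ratr q.1.2 : R) (ratr q.2) `<=` O >]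
  then ball (ratr q.1.1 : R) (ratr q.2) `*` ball (ratr q.1.2 : R) (ratr q.2) else set0.
have -> : O = \bigcup_q F q.
  apply/seteqP; split => [[x y] Oxy|[x y] [q _]]; last first.
    by rewrite /F; case: asboolP => // H [xb yb]; apply: H; split.
  have := oO; rewrite openE => /(_ _ Oxy) /nbhs_ballP[e /= e0 he].
  have [r /andP[r1 r2]] : exists r, e / 4 < (ratr r : R) < e / 2.
    have /rat_in_itvoo[r hr] : e / 4 < e / 2 by lra.
    by exists r; move: hr; rewrite in_itv.
  have near_rat (t : R) : exists q, t < ratr q < t + e / 4.
    have /rat_in_itvoo[q hq] : t < t + e / 4 by lra.
    by exists q; move: hq; rewrite in_itv.
  have [q1 /andP[h1 h2]] := near_rat x; have [q2 /andP[h3 h4]] := near_rat y.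
  exists (q1, q2, r) => //; rewrite /F; case: asboolP => [_|[]] /=.
    by split; rewrite -ball_normE /= ger0_norm ?subr_ge0 ?ltW//; lra.
  move=> [s t] [/=]; rewrite -!ball_normE /= => hs ht; apply: he; split; rewrite -ball_normE /=.
    rewrite distrC -(subrKA (ratr q1)) (le_lt_trans (ler_normD _ _))//.
    by rewrite distrC (ger0_norm (_ : 0 <= ratr q1 - x)) ?subr_ge0 ?ltW//; lra.
  rewrite distrC -(subrKA (ratr q2)) (le_lt_trans (ler_normD _ _))//.
  by rewrite distrC (ger0_norm (_ : 0 <= ratr q2 - y)) ?subr_ge0 ?ltW//; lra.
apply: countable_bigcupT_measurable; first exact: countableP.
move=> q; rewrite /F; case: asboolP => _; last exact: measurable0.
by apply: measurableX; rewrite ball_itv; exact: measurable_itv.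
Qed.

Lemma continuous_measurable_plane (R : realType) (g : R * R -> R) : continuous g ->
  measurable_fun [set: plane R] g.
Proof.
move=> /continuousP cg; apply: (measurability _ (RGenOpens.measurableE R)).
move=> _ [_ [a [b ->] <-]]; rewrite setTI; apply: open_measurable_plane.
exact/cg/interval_open.
Qed.

(** A positive value of h persists on a square, whose area is positive. *)
Lemma continuous_integral_eq0 (R : realType) (h : R * R -> R) : continuous h ->
  (forall p, 0 <= h p) ->
  (\int[area R]_p (h p)%:E = 0)%E ->
  forall p, h p = 0.
Proof.
move=> ch h0 hint p; apply/eqP; rewrite eq_le h0 andbT leNgt; apply/negP => hp.
have hp2 : 0 < h p / 2 by lra.
have /cvgrPdist_lt/(_ _ hp2)/nbhs_ballP[r /= r0 hr] := ch p.
pose B : set (plane R) := ball p.1 r `*` ball p.2 r.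
have mB : measurable B.
  by apply: measurableX; rewrite ball_itv; exact: measurable_itv.
have hB q : B q -> h p / 2 <= h q.
  move=> [q1 q2]; have : ball p r q by split.
  by move=> /hr; rewrite ltr_norml => /andP[? ?]; lra.
have mh : measurable_fun [set: plane R] (EFin \o (h : plane R -> R)).
  by apply/measurable_EFinP; exact: continuous_measurable_plane.
have : ((h p / 2)%:E * (area R) B <= 0)%E.
  rewrite -integral_cst// -hint.
  apply: (@le_trans _ _ (\int[area R]_(q in B) (h q)%:E)%E).
    apply: ge0_le_integral => //.
    - by move=> q _; rewrite lee_fin ltW.
    - exact: measurable_funTS.
  by apply: ge0_subset_integral => // q _; rewrite lee_fin.
rewrite /B area_setX//; try by rewrite ball_itv; exact: measurable_itv.
rewrite !(lebesgue_measure_ball _ (ltW r0)) -!EFinM lee_fin => H.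
have : 0 < h p / 2 * (r *+ 2 * (r *+ 2)) by rewrite !mulr_gt0// mulrn_wgt0.
lra.
Qed.

Lemma continuous_section1 (R : realType) (g : R * R -> R) (y : R) : continuous g ->
  continuous (fun x => g (x, y)).
Proof.
move=> cg x; apply: (@cvg_comp _ _ _ (fun x => (x, y)) g _ (nbhs (x, y)) _ _ (cg (x, y))).
by apply: (@cvg_pair _ _ _ (nbhs x) (nbhs x) (nbhs y)); [exact: cvg_id|exact: cvg_cst].
Qed.

Lemma continuous_section2 (R : realType) (g : R * R -> R) (x : R) : continuous g ->
  continuous (fun y => g (x, y)).
Proof.
move=> cg y; apply: (@cvg_comp _ _ _ (fun y => (x, y)) g _ (nbhs (x, y)) _ _ (cg (x, y))).
by apply: (@cvg_pair _ _ _ (nbhs y) (nbhs x) (nbhs y)); [exact: cvg_cst|exact: cvg_id].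
Qed.

Definition square (R : realType) (r : R) : set (plane R) :=
  `[- r, r] `*` `[- r, r].

Lemma measurable_square (R : realType) (r : R) : measurable (square r).
Proof. by apply: measurableX; exact: measurable_itv. Qed.

Lemma area_square_lty (R : realType) (r : R) : (area R (square r) < +oo)%E.
Proof.
rewrite /square product_measure1E; [|exact: measurable_itv..].
have I : (@lebesgue_measure R `[(- r)%R, r]%classic < +oo)%E.
  by rewrite lebesgue_measure_itv /= lte_fin; case: ifP => _; rewrite ?ltry// -EFinD ltry.
apply: lte_mul_pinfty => //.
by rewrite ge0_fin_numE//; exact: I.
Qed.

Lemma integrable_square (R : realType) (r : R) (g : R * R -> R) : 0 < r -> continuous g ->
  (area R).-integrable setT (EFin \o ((g : plane R -> R) \_ (square r))).
Proof.
move=> r0 cg; rewrite -restrict_EFin; apply/(integrable_mkcond _ (measurable_square r)).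
apply: measurable_bounded_integrable.
- exact: measurable_square.
- exact: area_square_lty.
- by apply: measurable_funTS; exact: continuous_measurable_plane.
- have /compact_bounded : compact (g @` (square r : set (R * R))).
    apply: continuous_compact; first exact: continuous_subspaceT.
    by apply: compact_setX; exact: segment_compact.
  move=> [M [Mr hM]]; exists M; split=> // N MN q hq.
  by apply: (hM N MN); exists q.
Qed.

Lemma ftc_segment (R : realType) (r : R) (S S1 : R -> R) : 0 < r -> continuous S1 ->
  (forall x : R, is_derive x 1 S (S1 x)) -> S r = 0 -> S (- r) = 0 ->
  (\int[@lebesgue_measure R]_(x in `[(- r)%R, r]) (S1 x)%:E = 0)%E.
Proof.
move=> r0 cS1 dS Sr SNr.
have cS : continuous S.
  by move=> x; apply: differentiable_continuous; apply/derivable1_diffP; exact: ex_derive.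
rewrite (@continuous_FTC2 _ S1 S (- r) r).
- by rewrite Sr SNr sube0.
- by lra.
- exact: continuous_subspaceT.
- split; first by move=> x _; exact: ex_derive.
  + by apply: cvg_at_right_filter; exact: cS.
  + by apply: cvg_at_left_filter; exact: cS.
- by move=> x _; rewrite derive1E derive_val.
Qed.

(** Fubini's theorem reduces this to the fundamental theorem of calculus on
    horizontal chords, whose end points carry the value 0. *)
Lemma integral_square_dx (R : realType) (r : R) (S S1 : R * R -> R) : 0 < r ->
  continuous S1 -> (forall x y : R, is_derive x 1 (fun s => S (s, y)) (S1 (x, y))) ->
  (forall y, S (r, y) = 0) -> (forall y, S (- r, y) = 0) ->
  (\int[area R]_p ((S1 \_ (square r)) p)%:E = 0)%E.
Proof.
move=> r0 cS1 dS Sr SNr.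
rewrite -(integral21_prod_meas1 (integrable_square r0 cS1)).
apply: integral0_eq => y _; rewrite /fubini_G /=.
have [hy|hy] := pselect (`[- r, r]%classic y); last first.
  apply: integral0_eq => x _; rewrite patchE; case: ifPn => //.
  by rewrite inE => -[_ /hy].
rewrite -[RHS](@ftc_segment _ r (fun s => S (s, y)) (fun s => S1 (s, y)))//; last first.
  exact: continuous_section1.
rewrite [RHS]integral_mkcond; apply: eq_integral => x _.
rewrite !patchE; have -> : ((x, y) \in square r) = (x \in `[- r, r]%classic) => //.
  by apply/idP/idP; rewrite !inE; [case|split].
by case: ifP.
Qed.

Lemma integral_square_dy (R : realType) (r : R) (S S1 : R * R -> R) : 0 < r ->
  continuous S1 -> (forall x y : R, is_derive y 1 (fun s => S (x, s)) (S1 (x, y))) ->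
  (forall x, S (x, r) = 0) -> (forall x, S (x, - r) = 0) ->
  (\int[area R]_p ((S1 \_ (square r)) p)%:E = 0)%E.
Proof.
move=> r0 cS1 dS Sr SNr.
rewrite -(integral12_prod_meas1 (integrable_square r0 cS1)).
apply: integral0_eq => x _; rewrite /fubini_F /=.
have [hx|hx] := pselect (`[- r, r]%classic x); last first.
  apply: integral0_eq => y _; rewrite patchE; case: ifPn => //.
  by rewrite inE => -[/hx].
rewrite -[RHS](@ftc_segment _ r (fun s => S (x, s)) (fun s => S1 (x, s)))//; last first.
  exact: continuous_section2.
rewrite [RHS]integral_mkcond; apply: eq_integral => y _.
rewrite !patchE; have -> : ((x, y) \in square r) = (y \in `[- r, r]%classic) => //.
  by apply/idP/idP; rewrite !inE; [case|split].
by case: ifP.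
Qed.

(** * The divergence theorem in the plane *)

Lemma is_derive_mul (R : realType) (x : R) (f g : R -> R) (a b : R) : is_derive x 1 f a ->
  is_derive x 1 g b ->
  is_derive x 1 (fun s => f s * g s) (a * g x + f x * b).
Proof.
move=> df dg; apply: is_derive_eq (is_deriveM df dg) _.
by rewrite /GRing.scale /=; ring.
Qed.

Lemma is_derive_add (R : realType) (x : R) (f g : R -> R) (a b : R) : is_derive x 1 f a ->
  is_derive x 1 g b ->
  is_derive x 1 (fun s => f s + g s) (a + b).
Proof. by move=> df dg; exact: is_deriveD. Qed.

Lemma is_derive_sub (R : realType) (x : R) (f g : R -> R) (a b : R) : is_derive x 1 f a ->
  is_derive x 1 g b ->
  is_derive x 1 (fun s => f s - g s) (a - b).
Proof. by move=> df dg; exact: is_deriveB. Qed.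

Lemma is_derive_opp (R : realType) (x : R) (f : R -> R) (a : R) : is_derive x 1 f a ->
  is_derive x 1 (fun s => - f s) (- a).
Proof. by move=> df; exact: is_deriveN. Qed.

Lemma is_derive_const (R : realType) (x a : R) : is_derive x 1 (fun=> a) 0.
Proof. exact: is_derive_cst. Qed.

Lemma is_derive_var (R : realType) (x : R) : is_derive x 1 (fun s : R => s) 1.
Proof. exact: is_derive_id. Qed.

Lemma is_derive_bump (R : realType) (x t : R) :
  is_derive x 1 (fun s => 1 - (s * t) * (s * t)) (- (2 * x * (t * t))).
Proof.
apply: is_derive_eq (is_derive_sub (is_derive_const x 1)
  (is_derive_mul (is_derive_mul (is_derive_var x) (is_derive_const x t))
    (is_derive_mul (is_derive_var x) (is_derive_const x t)))) _.
ring.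
Qed.

(** Continuity, kept folded so that the tactic [cts] can read off the shape of
    the function. *)
Definition cts_fun (R : realType) (T : topologicalType) (f : T -> R) : Prop := continuous f.

Lemma cts_add (R : realType) (T : topologicalType) (f g : T -> R) : cts_fun f -> cts_fun g ->
  cts_fun (fun x => f x + g x).
Proof. by move=> cf cg x; apply: cvgD; [exact: cf|exact: cg]. Qed.
Lemma cts_mul (R : realType) (T : topologicalType) (f g : T -> R) : cts_fun f -> cts_fun g ->
  cts_fun (fun x => f x * g x).
Proof. by move=> cf cg x; apply: cvgM; [exact: cf|exact: cg]. Qed.
Lemma cts_opp (R : realType) (T : topologicalType) (f : T -> R) : cts_fun f ->
  cts_fun (fun x => - f x).
Proof. by move=> cf x; apply: cvgN; exact: cf. Qed.
Lemma cts_const (R : realType) (T : topologicalType) (a : R) : cts_fun (fun _ : T => a).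
Proof. by move=> x; exact: cvg_cst. Qed.
Lemma cts_var (R : realType) : cts_fun (fun x : R => x).
Proof. by move=> x; exact: cvg_id. Qed.
Lemma cts_fst (R : realType) : cts_fun (fun x : R * R => x.1).
Proof. by move=> x; exact: cvg_fst. Qed.
Lemma cts_snd (R : realType) : cts_fun (fun x : R * R => x.2).
Proof. by move=> x; exact: cvg_snd. Qed.
Ltac cts := lazymatch goal with
 | |- cts_fun (fun _ => ?c) => exact: cts_const
 | |- cts_fun (fun p => @GRing.mul _ (@?f p) (@?g p)) => apply: (@cts_mul _ _ f g); cts
 | |- cts_fun (fun p => @Algebra.add _ (@?f p) (@?g p)) => apply: (@cts_add _ _ f g); cts
 | |- cts_fun (fun p => @Algebra.opp _ (@?f p)) => apply: (@cts_opp _ _ f); cts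
 | |- cts_fun (fun p => p.1) => exact: cts_fst
 | |- cts_fun (fun p => p.2) => exact: cts_snd
 | |- cts_fun (fun p => p) => exact: cts_var
 | H : cts_fun ?g |- cts_fun (fun p => ?g p) => exact: H
 | H : cts_fun ?g |- cts_fun ?g => exact: H
 end.
(** Multiply the field by the cutoff (1 - x^2 / r^2) (1 - y^2 / r^2), which
    vanishes on the boundary of [- r, r] x [- r, r]: the divergence of the
    product has integral zero there.  It equals the cutoff times P1 + Q1, plus
    terms of order 1 / r in P and Q; by dominated convergence only the integral
    of P1 + Q1 remains as r grows. *)
Lemma divergence_eq0 (R : realType) (P Q P1 Q1 : R * R -> R) :
  cts_fun P -> cts_fun Q -> cts_fun P1 -> cts_fun Q1 ->
  (forall x y : R, is_derive x 1 (fun s => P (s, y)) (P1 (x, y))) ->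
  (forall x y : R, is_derive y 1 (fun s => Q (x, s)) (Q1 (x, y))) ->
  (area R).-integrable setT (EFin \o (P : plane R -> R)) ->
  (area R).-integrable setT (EFin \o (Q : plane R -> R)) ->
  (area R).-integrable setT (EFin \o ((fun p => P1 p + Q1 p) : plane R -> R)) ->
  (\int[area R]_p (P1 p + Q1 p)%:E = 0)%E.
Proof.
move=> cP cQ cP1 cQ1 dP dQ iP iQ iS.
(* the partial derivatives of the two coordinates of the cut-off field, t = 1 / r *)
pose A t (p : plane R) : R := (1 - (p.2 * t) * (p.2 * t)) *
  ((- (2 * p.1 * (t * t))) * P p + (1 - (p.1 * t) * (p.1 * t)) * P1 p).
pose B t (p : plane R) : R := (1 - (p.1 * t) * (p.1 * t)) *
  ((- (2 * p.2 * (t * t))) * Q p + (1 - (p.2 * t) * (p.2 * t)) * Q1 p).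
have cA t : continuous (A t : R * R -> R) by rewrite -/(cts_fun _) /A; cts.
have cB t : continuous (B t : R * R -> R) by rewrite -/(cts_fun _) /B; cts.
pose r (n : nat) : R := n.+1%:R.
have r0 n : 0 < r n by rewrite ltr0n.
pose H n := (fun p => A (r n)^-1 p + B (r n)^-1 p) \_ (square (r n)).
have intA n : (\int[area R]_p ((A (r n)^-1 \_ (square (r n))) p)%:E = 0)%E.
  apply: (@integral_square_dx _ _ (fun p => (1 - (p.2 * (r n)^-1) * (p.2 * (r n)^-1)) *
    ((1 - (p.1 * (r n)^-1) * (p.1 * (r n)^-1)) * P p))) => //= [x y|y|y].
  - apply: is_derive_eq (is_derive_mul (is_derive_const _ _)
      (is_derive_mul (is_derive_bump _ _) (dP x y))) _.
    by rewrite mul0r add0r /A.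
  - by rewrite mulfV ?gt_eqF// mulr1 subrr mul0r mulr0.
  - by rewrite mulNr mulfV ?gt_eqF// mulrNN mulr1 subrr mul0r mulr0.
have intB n : (\int[area R]_p ((B (r n)^-1 \_ (square (r n))) p)%:E = 0)%E.
  apply: (@integral_square_dy _ _ (fun p => (1 - (p.1 * (r n)^-1) * (p.1 * (r n)^-1)) *
    ((1 - (p.2 * (r n)^-1) * (p.2 * (r n)^-1)) * Q p))) => //= [x y|y|y].
  - apply: is_derive_eq (is_derive_mul (is_derive_const _ _)
      (is_derive_mul (is_derive_bump _ _) (dQ x y))) _.
    by rewrite mul0r add0r /B.
  - by rewrite mulfV ?gt_eqF// mulr1 subrr mul0r mulr0.
  - by rewrite mulNr mulfV ?gt_eqF// mulrNN mulr1 subrr mul0r mulr0.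
have HE n p : H n p = (A (r n)^-1 \_ (square (r n))) p + (B (r n)^-1 \_ (square (r n))) p.
  by rewrite /H !patchE; case: ifP => // _; rewrite /point/= addr0.
have iA n := integrable_square (r0 n) (cA (r n)^-1).
have iB n := integrable_square (r0 n) (cB (r n)^-1).
have intH n : (\int[area R]_p (H n p)%:E = 0)%E.
  rewrite (_ : (fun p => _) = ((EFin \o (A (r n)^-1%R \_ (square (r n)))) \+ (EFin \o
    (B (r n)^-1%R \_ (square (r n)))))%E); last first.
    by apply/funext => p; rewrite HE EFinD.
  rewrite integralD//; transitivity (0 + 0 : \bar R)%E; last by rewrite adde0.
  by congr (_ + _)%E; [exact: intA|exact: intB].
pose dom (p : plane R) : R := `|P1 p + Q1 p| + (2 * `|P p| + 2 * `|Q p|).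
have idom : (area R).-integrable setT (EFin \o dom).
  have h1 : (area R).-integrable setT (EFin \o (fun p : plane R => `|P1 p + Q1 p|)).
    by have := integrable_abse iS.
  have h2 : (area R).-integrable setT (EFin \o (fun p : plane R => 2 * `|P p|)).
    by have := integrableZl measurableT 2 (integrable_abse iP).
  have h3 : (area R).-integrable setT (EFin \o (fun p : plane R => 2 * `|Q p|)).
    by have := integrableZl measurableT 2 (integrable_abse iQ).
  have := integrableD measurableT h1 (integrableD measurableT h2 h3).
  by [].
(* on the square |x t| and |y t| are at most 1: the cutoff is at most 1, its gradient at most 2 *)
have Hdom n p : `|H n p| <= dom p.
  rewrite /H patchE; case: ifPn => [|_]; last by rewrite /dom normr0 !addr_ge0// mulr_ge0.
  rewrite inE => -[]; rewrite /= !in_itv /= => /andP[x1 x2] /andP[y1 y2].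
  have bd (s : R) : - r n <= s <= r n -> -1 <= s * (r n)^-1 <= 1.
    by move=> /andP[s1 s2]; rewrite ler_pdivrMr// ler_pdivlMr// mul1r mulN1r s1 s2.
  have t1 : 0 < (r n)^-1 <= 1.
    by rewrite invr_gt0 r0 invf_le1// ler1n.
  set t := (r n)^-1 in bd t1 *.
  have /andP[xt1 xt2] : -1 <= p.1 * t <= 1 by apply: bd; rewrite x1.
  have /andP[yt1 yt2] : -1 <= p.2 * t <= 1 by apply: bd; rewrite y1.
  have bump01 (s : R) : -1 <= s -> s <= 1 -> 0 <= 1 - s * s <= 1.
    move=> s1 s2; rewrite lerBlDr lerDl -expr2 sqr_ge0 andbT.
    by rewrite -(expr1n _ 2) subr_sqr mulr_ge0 ?subr_ge0// addrC -lerBlDr sub0r.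
  have cx := bump01 _ xt1 xt2; have cy := bump01 _ yt1 yt2.
  have -> : A t p + B t p =
    (1 - p.1 * t * (p.1 * t)) * (1 - p.2 * t * (p.2 * t)) * (P1 p + Q1 p) +
    (((1 - p.2 * t * (p.2 * t)) * (- (p.1 * t) * t)) * (2 * P p) +
     ((1 - p.1 * t * (p.1 * t)) * (- (p.2 * t) * t)) * (2 * Q p)).
    by rewrite /A /B; ring.
  case/andP: cx => cx0 cx1; case/andP: cy => cy0 cy1; case/andP: t1 => t0 t1.
  have n1 (z : R) : 0 <= z <= 1 -> `|z| <= 1 by move=> /andP[? ?]; rewrite ger0_norm.
  have nx : `|p.1 * t| <= 1 by rewrite ler_norml xt1.
  have ny : `|p.2 * t| <= 1 by rewrite ler_norml yt1.
  have nt : `|t| <= 1 by rewrite n1// ltW.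
  have ncx : `|1 - p.1 * t * (p.1 * t)| <= 1 by rewrite n1// cx0.
  have ncy : `|1 - p.2 * t * (p.2 * t)| <= 1 by rewrite n1// cy0.
  have two (z : R) : `|2 * z| = 2 * `|z| by rewrite normrM ger0_norm.
  rewrite /dom; apply: le_trans (ler_normD _ _) _; apply: lerD.
    by rewrite normrM ler_piMl// normrM mulr_ile1.
  apply: le_trans (ler_normD _ _) _; apply: lerD.
    by rewrite normrM two ler_piMl ?mulr_ge0// normrM mulr_ile1// normrM mulr_ile1// normrN.
  by rewrite normrM two ler_piMl ?mulr_ge0// normrM mulr_ile1// normrM mulr_ile1// normrN.
have Hcvg p : H n p @[n --> \oo] --> P1 p + Q1 p.
  have E : \forall n \near \oo, A (r n)^-1 p + B (r n)^-1 p = H n p.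
    near=> n; rewrite /H patchE mem_set//.
    have hr : `|p.1| + `|p.2| <= r n.
      near: n; exists (Num.truncn (`|p.1| + `|p.2|)).+1 => // n /= hn.
      apply: ltW; apply: lt_le_trans (truncnS_gt _) _.
      by rewrite /r ler_nat; apply: leqW.
    by split; rewrite /= in_itv /= -ler_norml; apply: le_trans hr; rewrite ?lerDl ?lerDr.
  apply: cvg_trans (near_eq_cvg E) _.
  have c0 : (r n)^-1 @[n --> \oo] --> (0 : R) by exact: cvg_harmonic.
  have -> : P1 p + Q1 p = A 0 p + B 0 p by rewrite /A /B; ring.
  have : cts_fun (fun t => A t p + B t p) by rewrite /A /B; cts.
  by move=> /(_ 0) /(cvg_comp _ _ c0).
have mS : measurable_fun setT (EFin \o ((fun p => P1 p + Q1 p) : plane R -> R)).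
  by have /measurable_int := iS.
have mH n : measurable_fun setT (EFin \o (H n : plane R -> R)).
  have /measurable_int := integrableD measurableT (iA n) (iB n).
  by congr measurable_fun; apply/funext => p; rewrite /= HE EFinD.
have ptw : {ae area R, forall p : plane R, setT p ->
    (EFin \o H n) p @[n --> \oo] --> (EFin \o ((fun p => P1 p + Q1 p) : plane R -> R)) p}.
  by apply: aeW => p _; apply: cvg_EFin; [exact: nearW|exact: Hcvg].
have bnd : {ae area R, forall p : plane R, forall n, setT p ->
    (`|(EFin \o H n) p| <= (EFin \o dom) p)%E}.
  by apply: aeW => p n _; rewrite lee_fin; exact: Hdom.
have [_ _] := dominated_convergence measurableT mH mS ptw idom bnd.
rewrite (_ : [sequence _]_n = cst 0%E); last by apply/funext => n; exact: intH.
by move=> h; exact: (cvg_unique (@ereal_hausdorff R) h (@cvg_cst _ _ _ _ _)).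
Unshelve. all: by end_near.
Qed.

(** * The Fock norm and the commutation relation *)

Definition plane_re (R : realType) (f : R[i] -> R[i]) (p : R * R) : R := re (f (p.1 +i* p.2)).
Definition plane_im (R : realType) (f : R[i] -> R[i]) (p : R * R) : R := im (f (p.1 +i* p.2)).

Lemma continuous_plane (R : realType) (f : R[i] -> R[i]) : ccts f ->
  cts_fun (plane_re f) /\ cts_fun (plane_im f).
Proof.
move=> cf.
suff H : forall (p : R * R) (e : R), 0 < e -> \forall q \near p,
    nrm (f (p.1 +i* p.2) - f (q.1 +i* q.2)) <= e.
  split=> p; apply/cvgrPdist_le => e e0; have := H p e e0; apply: filterS => q hq.
    apply: le_trans hq; apply: le_trans (ler_Re_nrm _).
    by rewrite /plane_re; case: (f _) => ? ?; case: (f _) => ? ?.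
  apply: le_trans hq; apply: le_trans (ler_Im_nrm _).
  by rewrite /plane_im; case: (f _) => ? ?; case: (f _) => ? ?.
move=> p e e0; have [d d0 hd] := cf (p.1 +i* p.2) e e0.
apply/nbhs_ballP; exists (d / 2) => /=; first lra.
move=> q [q1 q2]; rewrite nrmB.
have := hd ((q.1 - p.1) +i* (q.2 - p.2)).
rewrite (_ : (p.1 +i* p.2) + _ = q.1 +i* q.2); last by simpc; rewrite !subrKC.
apply; apply: le_lt_trans (ler_nrm_ReIm _) _; rewrite /=.
move: q1 q2; rewrite -!ball_normE /= !(distrC p.1) !(distrC p.2); lra.
Qed.

Lemma is_derive_plane1 (R : realType) (f df : R[i] -> R[i]) (x y : R) :
  (forall z, cdiff f z (df z)) ->
  is_derive x 1 (fun s => plane_re f (s, y)) (plane_re df (x, y)) /\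
  is_derive x 1 (fun s => plane_im f (s, y)) (plane_im df (x, y)).
Proof.
move=> hf; have := cdiff_rdiff (hf _) (rdiff_horizontal y x).
by rewrite mulr1 => /rdiffP.
Qed.

Lemma is_derive_plane2 (R : realType) (f df : R[i] -> R[i]) (x y : R) :
  (forall z, cdiff f z (df z)) ->
  is_derive y 1 (fun s => plane_re f (x, s)) (- plane_im df (x, y)) /\
  is_derive y 1 (fun s => plane_im f (x, s)) (plane_re df (x, y)).
Proof.
move=> hf; have := cdiff_rdiff (hf _) (rdiff_vertical x y).
move=> /rdiffP; rewrite /plane_re /plane_im.
by case: (df _) => a b /=; rewrite !mulr0 !mulr1 sub0r addr0.
Qed.

Definition gauss_weight (R : realType) (p : R * R) : R :=
  pi^-1 * expR (- (p.1 * p.1 + p.2 * p.2)).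

Lemma fock_densityE (R : realType) (p : R * R) :
  fock_density (p.1 +i* p.2) = gauss_weight p.
Proof. by rewrite /fock_density sqr_nrm /= !expr2. Qed.

Lemma gauss_weight_gt0 (R : realType) (p : R * R) : 0 < gauss_weight p.
Proof. by rewrite mulr_gt0 ?expR_gt0// invr_gt0 pi_gt0. Qed.

Lemma continuous_gauss_weight (R : realType) : cts_fun (@gauss_weight R).
Proof.
apply: cts_mul; first exact: cts_const.
move=> p; apply: (@cvg_comp _ _ _ (fun p : R * R => - (p.1 * p.1 + p.2 * p.2)) expR _
  (nbhs (- (p.1 * p.1 + p.2 * p.2)))).
  have : cts_fun (fun p : R * R => - (p.1 * p.1 + p.2 * p.2)) by cts.
  exact.
exact: continuous_expR.
Qed.

Lemma is_derive_gauss1 (R : realType) (x y : R) :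
  is_derive x 1 (fun s => gauss_weight (s, y)) (- (2 * x) * gauss_weight (x, y)).
Proof.
rewrite /gauss_weight /=.
have d : is_derive x 1 (fun s : R => - (s * s + y * y)) (- (2 * x)).
  apply: is_derive_eq (is_derive_opp (is_derive_add
    (is_derive_mul (is_derive_var x) (is_derive_var x)) (is_derive_const x (y * y)))) _.
  by ring.
have de : is_derive x 1 (expR \o (fun s : R => - (s * s + y * y))) (expR (- (x * x + y * y))
  * - (2 * x)).
  exact: is_derive1_comp.
by apply: is_derive_eq (is_derive_mul (is_derive_const x _) de) _; ring.
Qed.

Lemma is_derive_gauss2 (R : realType) (x y : R) :
  is_derive y 1 (fun s => gauss_weight (x, s)) (- (2 * y) * gauss_weight (x, y)).
Proof.
have := is_derive_gauss1 y x; rewrite /gauss_weight /=.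
rewrite (addrC (x * x)); congr (is_derive _ _ _); apply/funext => s.
by rewrite (addrC (x * x)).
Qed.

Definition fock_integrand (R : realType) (h : R[i] -> R[i]) (p : plane R) : R :=
  (plane_re h p * plane_re h p + plane_im h p * plane_im h p) * gauss_weight p.

Lemma fock_normE (R : realType) (h : R[i] -> R[i]) :
  fock_norm h = sqrte (\int[area R]_p (fock_integrand h p)%:E).
Proof.
by rewrite /fock_norm; congr sqrte; apply: eq_integral => p _; rewrite fock_densityE sqr_nrm !expr2.
Qed.

Lemma fock_integrand_ge0 (R : realType) (h : R[i] -> R[i]) (p : plane R) :
  0 <= fock_integrand h p.
Proof. by rewrite mulr_ge0 ?addr_ge0 -?expr2 ?sqr_ge0// ltW// gauss_weight_gt0. Qed.

Lemma continuous_fock_integrand (R : realType) (h : R[i] -> R[i]) : ccts h ->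
  cts_fun (fock_integrand h : R * R -> R).
Proof.
move=> /continuous_plane[c1 c2]; have cw := @continuous_gauss_weight R.
by rewrite /fock_integrand; cts.
Qed.

Lemma integrable_fock_integrand (R : realType) (h : R[i] -> R[i]) : ccts h ->
  (\int[area R]_p (fock_integrand h p)%:E < +oo)%E ->
  (area R).-integrable setT (EFin \o fock_integrand h).
Proof.
move=> ch fin; apply/integrableP; split.
  by apply/measurable_EFinP; exact: (continuous_measurable_plane (continuous_fock_integrand ch)).
apply: le_lt_trans fin; rewrite le_eqVlt; apply/orP; left; apply/eqP.
by apply: eq_integral => p _; rewrite /= ger0_norm// fock_integrand_ge0.
Qed.

(** As d/dz and multiplication by z are adjoint, their sum is symmetric and
    their difference is skew-symmetric: up to normalization, these are the
    position and momentum operators of the oscillator, shifted by a and i b. *)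
Definition position_op (R : realType) (f : R[i] -> R[i]) (a : R) : R[i] -> R[i] :=
  fun z => cderive f z + z * f z - a%:C * f z.
Definition momentum_op (R : realType) (f : R[i] -> R[i]) (b : R) : R[i] -> R[i] :=
  fun z => cderive f z - z * f z - 'i%C * b%:C * f z.

(** The integrand of Re <u, v>. *)
Definition fock_cross (R : realType) (u v : R[i] -> R[i]) (p : plane R) : R :=
  (plane_re u p * plane_re v p + plane_im u p * plane_im v p) * gauss_weight p.

Lemma ler_norm_dot (R : realType) (a b c d : R) :
  2 * `|a * c + b * d| <= (a * a + b * b) + (c * c + d * d).
Proof.
have h1 := sqr_ge0 (a + c); have h2 := sqr_ge0 (b + d).
have h3 := sqr_ge0 (a - c); have h4 := sqr_ge0 (b - d).
by case: (lerP 0 (a * c + b * d)) => h; [rewrite ger0_norm//|rewrite ltr0_norm//]; lra.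
Qed.

(** Here p0 + i q0, p1 + i q1 and p2 + i q2 stand for f, f' and f'', and
    A + i B and C + i D for u and v.  In the field (P, Q), the first coordinate
    is Re (u conj(f)) w and the second Im (f conj(v)) w; with this choice the
    second derivatives cancel in the divergence, which is twice the integrand. *)
Lemma real_commutator_identity (R : realType) (p0 q0 p1 q1 p2 q2 : R * R -> R) (a b : R) :
  cts_fun p0 -> cts_fun q0 -> cts_fun p1 -> cts_fun q1 -> cts_fun p2 -> cts_fun q2 ->
  (forall x y : R, is_derive x 1 (fun s => p0 (s, y)) (p1 (x, y))) ->
  (forall x y : R, is_derive x 1 (fun s => q0 (s, y)) (q1 (x, y))) ->
  (forall x y : R, is_derive x 1 (fun s => p1 (s, y)) (p2 (x, y))) ->
  (forall x y : R, is_derive x 1 (fun s => q1 (s, y)) (q2 (x, y))) ->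
  (forall x y : R, is_derive y 1 (fun s => p0 (x, s)) (- q1 (x, y))) ->
  (forall x y : R, is_derive y 1 (fun s => q0 (x, s)) (p1 (x, y))) ->
  (forall x y : R, is_derive y 1 (fun s => p1 (x, s)) (- q2 (x, y))) ->
  (forall x y : R, is_derive y 1 (fun s => q1 (x, s)) (p2 (x, y))) ->
  let A (p : plane R) := p1 p + (p.1 * p0 p - p.2 * q0 p) - a * p0 p in
  let B (p : plane R) := q1 p + (p.1 * q0 p + p.2 * p0 p) - a * q0 p in
  let C (p : plane R) := p1 p - (p.1 * p0 p - p.2 * q0 p) + b * q0 p in
  let D (p : plane R) := q1 p - (p.1 * q0 p + p.2 * p0 p) - b * p0 p in
  let w := @gauss_weight R in
  (area R).-integrable setT (EFin \o ((fun p => (p0 p * p0 p + q0 p * q0 p) * w p) : plane R ->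
    R)) ->
  (area R).-integrable setT (EFin \o ((fun p => (A p * A p + B p * B p) * w p) : plane R -> R)) ->
  (area R).-integrable setT (EFin \o ((fun p => (C p * C p + D p * D p) * w p) : plane R -> R)) ->
  (\int[area R]_p ((A p * C p + B p * D p) * w p + (p0 p * p0 p + q0 p * q0 p) * w p)%:E = 0)%E.
Proof.
move=> cp0 cq0 cp1 cq1 cp2 cq2 xp0 xq0 xp1 xq1 yp0 yq0 yp1 yq1 A B C D w if_ iu iv.
have cw : cts_fun w by exact: continuous_gauss_weight.
pose P (p : R * R) := (A p * p0 p + B p * q0 p) * w p.
pose Q (p : R * R) := (q0 p * C p - p0 p * D p) * w p.
pose P1 (p : R * R) :=
  ((p2 p + (p0 p + p.1 * p1 p - p.2 * q1 p) - a * p1 p) * p0 p + A p * p1 p +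
   ((q2 p + (q0 p + p.1 * q1 p + p.2 * p1 p) - a * q1 p) * q0 p + B p * q1 p)) * w p +
  (A p * p0 p + B p * q0 p) * (- (2 * p.1) * w p).
pose Q1 (p : R * R) :=
  (p1 p * C p + q0 p * (- q2 p + (p.1 * q1 p + q0 p + p.2 * p1 p) + b * p1 p) +
   (q1 p * D p - p0 p * (p2 p - (p.1 * p1 p + p0 p - p.2 * q1 p) + b * q1 p))) * w p +
  (q0 p * C p - p0 p * D p) * (- (2 * p.2) * w p).
have cP : cts_fun P by rewrite /P /A /B; cts.
have cQ : cts_fun Q by rewrite /Q /C /D; cts.
have cP1 : cts_fun P1 by rewrite /P1 /A /B; cts.
have cQ1 : cts_fun Q1 by rewrite /Q1 /C /D; cts.
have dP (x y : R) : is_derive x 1 (fun s => P (s, y)) (P1 (x, y)).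
  have d0 := xp0 x y; have e0 := xq0 x y; have d1 := xp1 x y; have e1 := xq1 x y.
  have dv := is_derive_var x; have dc c := is_derive_const x c.
  have dA := is_derive_sub (is_derive_add d1 (is_derive_sub (is_derive_mul dv d0) (is_derive_mul
    (dc y) e0))) (is_derive_mul (dc a) d0).
  have dB := is_derive_sub (is_derive_add e1 (is_derive_add (is_derive_mul dv e0) (is_derive_mul
    (dc y) d0))) (is_derive_mul (dc a) e0).
  apply: is_derive_eq (is_derive_mul (is_derive_add (is_derive_mul dA d0) (is_derive_mul dB e0))
    (is_derive_gauss1 x y)) _.
  rewrite /P1 /A /B /w /=; ring.
have dQ (x y : R) : is_derive y 1 (fun s => Q (x, s)) (Q1 (x, y)).
  have d0 := yp0 x y; have e0 := yq0 x y; have d1 := yp1 x y; have e1 := yq1 x y.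
  have dv := is_derive_var y; have dc c := is_derive_const y c.
  have dC := is_derive_add (is_derive_sub d1 (is_derive_sub (is_derive_mul (dc x) d0)
    (is_derive_mul dv e0))) (is_derive_mul (dc b) e0).
  have dD := is_derive_sub (is_derive_sub e1 (is_derive_add (is_derive_mul (dc x) e0)
    (is_derive_mul dv d0))) (is_derive_mul (dc b) d0).
  apply: is_derive_eq (is_derive_mul (is_derive_sub (is_derive_mul e0 dC) (is_derive_mul d0 dD))
    (is_derive_gauss2 x y)) _.
  rewrite /Q1 /C /D /w /=; ring.
have SE p : P1 p + Q1 p = 2 * ((A p * C p + B p * D p) * w p + (p0 p * p0 p + q0 p * q0 p) * w p).
  by rewrite /P1 /Q1 /A /B /C /D; ring.
have w0 p : 0 <= w p by rewrite ltW// gauss_weight_gt0.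
have dom (F G : R * R -> R) : cts_fun F -> (forall p, `|F p| <= G p) ->
    (area R).-integrable setT (EFin \o (G : plane R -> R)) ->
    (area R).-integrable setT (EFin \o (F : plane R -> R)).
  move=> cF FG; apply: le_integrable => //.
    by apply/measurable_EFinP; exact: (continuous_measurable_plane cF).
  by move=> p _; rewrite lee_fin; apply: le_trans (FG p) _; exact: ler_norm.
have iP : (area R).-integrable setT (EFin \o (P : plane R -> R)).
  apply: (dom _ (fun p => (A p * A p + B p * B p) * w p + (p0 p * p0 p + q0 p * q0 p) * w p))
    => //; last first.
    exact: (integrableD measurableT iu if_).
  move=> p; rewrite -mulrDl /P normrM (ger0_norm (w0 p)).
  rewrite ler_wpM2r//; have := ler_norm_dot (A p) (B p) (p0 p) (q0 p).
  by have := normr_ge0 (A p * p0 p + B p * q0 p); lra.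
have iQ : (area R).-integrable setT (EFin \o (Q : plane R -> R)).
  apply: (dom _ (fun p => (C p * C p + D p * D p) * w p + (p0 p * p0 p + q0 p * q0 p) * w p))
    => //; last first.
    exact: (integrableD measurableT iv if_).
  move=> p; rewrite -mulrDl /Q normrM (ger0_norm (w0 p)).
  rewrite ler_wpM2r//; have := ler_norm_dot (C p) (D p) (q0 p) (- p0 p).
  rewrite mulrNN (_ : _ + _ = q0 p * C p - p0 p * D p); last by ring.
  by have := normr_ge0 (q0 p * C p - p0 p * D p); lra.
have cS : cts_fun (fun p => P1 p + Q1 p) by exact: cts_add.
have iS : (area R).-integrable setT (EFin \o ((fun p => P1 p + Q1 p) : plane R -> R)).
  apply: (dom _ (fun p => ((A p * A p + B p * B p) * w p + (p0 p * p0 p + q0 p * q0 p) * w p) +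
    ((C p * C p + D p * D p) * w p + (p0 p * p0 p + q0 p * q0 p) * w p))) => //; last first.
    exact: (integrableD measurableT (integrableD measurableT iu if_) (integrableD measurableT iv
      if_)).
  move=> p; rewrite SE -!mulrDl mulrA normrM (ger0_norm (w0 p)).
  rewrite ler_wpM2r//; have := ler_norm_dot (A p) (B p) (C p) (D p).
  rewrite normrM (ger0_norm (_ : 0 <= 2))//;
    have := ler_normD (A p * C p + B p * D p) (p0 p * p0 p + q0 p * q0 p).
  rewrite (ger0_norm (_ : 0 <= p0 p * p0 p + q0 p * q0 p)) ?addr_ge0 -?expr2 ?sqr_ge0//; lra.
have := divergence_eq0 cP cQ cP1 cQ1 dP dQ iP iQ iS.
pose T (p : plane R) : R := (A p * C p + B p * D p) * w p + (p0 p * p0 p + q0 p * q0 p) * w p.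
have iT : (area R).-integrable setT (EFin \o T).
  have := integrableZl measurableT 2^-1 iS; congr integrable; apply/funext => p.
  by rewrite /= SE -EFinM mulKf.
rewrite (_ : (fun p => _) = (fun p => 2%:E * (EFin \o T) p)%E); last first.
  by apply/funext => p; rewrite SE EFinM.
rewrite integralZl// => /eqP; rewrite mule_eq0 eqe pnatr_eq0 /= => /eqP; exact.
Qed.

(** Re <u, v> = - |f|^2, the integrated commutation relation. *)
Lemma fock_commutator (R : realType) (f : R[i] -> R[i]) (a b : R) : entire f ->
  let u := position_op f a in let v := momentum_op f b in
  ccts u -> ccts v ->
  (\int[area R]_p (fock_integrand f p)%:E < +oo)%E ->
  (\int[area R]_p (fock_integrand u p)%:E < +oo)%E ->
  (\int[area R]_p (fock_integrand v p)%:E < +oo)%E ->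
  (\int[area R]_p (fock_cross u v p + fock_integrand f p)%:E = 0)%E.
Proof.
move=> ef u v cu cv If Iu Iv.
have ef1 := entire_cderive ef; have ef2 := entire_cderive ef1.
have df := entire_cdiff ef; have df1 := entire_cdiff ef1.
have cf := cdiff_ccts df; have cf1 := cdiff_ccts df1.
have cf2 := cdiff_ccts (entire_cdiff ef2).
pose p0 := plane_re f; pose q0 := plane_im f.
pose p1 := plane_re (cderive f); pose q1 := plane_im (cderive f).
pose p2 := plane_re (cderive (cderive f)); pose q2 := plane_im (cderive (cderive f)).
have [cp0 cq0] := continuous_plane cf; have [cp1 cq1] := continuous_plane cf1.
have [cp2 cq2] := continuous_plane cf2.
rewrite -/p0 -/q0 in cp0 cq0; rewrite -/p1 -/q1 in cp1 cq1; rewrite -/p2 -/q2 in cp2 cq2.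
have cw := @continuous_gauss_weight R.
pose A (p : plane R) := p1 p + (p.1 * p0 p - p.2 * q0 p) - a * p0 p.
pose B (p : plane R) := q1 p + (p.1 * q0 p + p.2 * p0 p) - a * q0 p.
pose C (p : plane R) := p1 p - (p.1 * p0 p - p.2 * q0 p) + b * q0 p.
pose D (p : plane R) := q1 p - (p.1 * q0 p + p.2 * p0 p) - b * p0 p.
have uA p : plane_re u p = A p.
  by rewrite /plane_re /u /position_op /A /p0 /q0 /p1 /plane_re /plane_im; case: (f _) => ? ?;
    case: (cderive _ _) => ? ? /=; ring.
have uB p : plane_im u p = B p.
  by rewrite /plane_im /u /position_op /B /p0 /q0 /q1 /plane_re /plane_im; case: (f _) => ? ?;
    case: (cderive _ _) => ? ? /=; ring.
have vC p : plane_re v p = C p.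
  by rewrite /plane_re /v /momentum_op /C /p0 /q0 /p1 /plane_re /plane_im; case: (f _) => ? ?;
    case: (cderive _ _) => ? ? /=; ring.
have vD p : plane_im v p = D p.
  by rewrite /plane_im /v /momentum_op /D /p0 /q0 /q1 /plane_re /plane_im; case: (f _) => ? ?;
    case: (cderive _ _) => ? ? /=; ring.
have if_ := integrable_fock_integrand cf If.
have iu := integrable_fock_integrand cu Iu.
have iv := integrable_fock_integrand cv Iv.
have D1 := fun x y => is_derive_plane1 x y df; have D2 := fun x y => is_derive_plane1 x y df1.
have E1 := fun x y => is_derive_plane2 x y df; have E2 := fun x y => is_derive_plane2 x y df1.
rewrite (_ : (fun p => _) = (fun p => ((A p * C p + B p * D p) * gauss_weight p +
    (p0 p * p0 p + q0 p * q0 p) * gauss_weight p)%:E)); last first.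
  by apply/funext => p; rewrite /fock_cross uA uB vC vD.
apply: (@real_commutator_identity R p0 q0 p1 q1 p2 q2 a b) => //.
- by move=> x y; have [] := D1 x y.
- by move=> x y; have [] := D1 x y.
- by move=> x y; have [] := D2 x y.
- by move=> x y; have [] := D2 x y.
- by move=> x y; have [] := E1 x y.
- by move=> x y; have [] := E1 x y.
- by move=> x y; have [] := E2 x y.
- by move=> x y; have [] := E2 x y.
- by move: iu; congr integrable; apply/funext => p; rewrite /= /fock_integrand uA uB.
- by move: iv; congr integrable; apply/funext => p; rewrite /= /fock_integrand vC vD.
Qed.

(** * The complex exponential and linear differential equations *)

Lemma expC0 (R : realType) : expC (0 : R[i]) = 1.
Proof. by rewrite -[0 : R[i]]/(0 +i* 0) /expC expR0 cos0 sin0 mul1r. Qed.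

Lemma nrm_expC (R : realType) (z : R[i]) : nrm (expC z) = expR (re z).
Proof.
case: z => x y; rewrite /expC nrmM nrmR ger0_norm ?expR_ge0//.
by rewrite nrmE cos2Dsin2 sqrtr1 mulr1.
Qed.

Lemma expCNK (R : realType) (z : R[i]) : expC (- z) * expC z = 1.
Proof.
case: z => x y; rewrite /expC /= expRN cosN sinN.
rewrite mulrACA -rmorphM mulVf ?gt_eqF ?expR_gt0//= mul1r.
apply/eqP; rewrite eq_complex /=; apply/andP; split; apply/eqP.
  by rewrite -(cos2Dsin2 y); ring.
by ring.
Qed.

Lemma rdiff_expC (R : realType) (g : R -> R[i]) (t : R) (l : R[i]) :
  rdiff g t l -> rdiff (fun s => expC (g s)) t (expC (g t) * l).
Proof.
move=> /rdiffP[d1 d2].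
have de : is_derive t 1 (expR \o (re \o g)) (expR (re (g t)) * re l).
  exact: is_derive1_comp.
have dc : is_derive t 1 (cos \o (im \o g)) (- sin (im (g t)) * im l).
  exact: is_derive1_comp.
have ds : is_derive t 1 (sin \o (im \o g)) (cos (im (g t)) * im l).
  exact: is_derive1_comp.
apply/rdiffP; split.
  rewrite (_ : _ \o _ = fun s => (expR \o (re \o g)) s * (cos \o (im \o g)) s); last first.
    by apply/funext => s; rewrite /= /expC; case: (g s) => x y /=; ring.
  apply: is_derive_eq (is_derive_mul de dc) _.
  by rewrite /= /expC; case: (g t) => x y; case: (l) => ? ? /=; ring.
rewrite (_ : _ \o _ = fun s => (expR \o (re \o g)) s * (sin \o (im \o g)) s); last first.
  by apply/funext => s; rewrite /= /expC; case: (g s) => x y /=; ring.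
apply: is_derive_eq (is_derive_mul de ds) _.
by rewrite /= /expC; case: (g t) => x y; case: (l) => ? ? /=; ring.
Qed.

Lemma rdiff_quadratic (R : realType) (k b z w : R[i]) (t : R) :
  rdiff (fun s : R => k * (z + w * s%:C) ^+ 2 + b * (z + w * s%:C)) t
    ((2 * k * (z + w * t%:C) + b) * w).
Proof.
have dl := rdiff_line z w t.
have := rdiffD (rdiffZ k (rdiffM dl dl)) (rdiffZ b dl).
move=> h; apply: rdiff_eq h _; ring.
Qed.

(** The product of f and exp (- k z^2 - b z) has derivative zero along the
    segment from 0 to z. *)
Lemma linear_ode_gaussian (R : realType) (f df : R[i] -> R[i]) (k b : R[i]) :
  (forall z, cdiff f z (df z)) ->
  (forall z, df z = (2 * k * z + b) * f z) ->
  forall z, f z = f 0 * expC (k * z ^+ 2 + b * z).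
Proof.
move=> hf ode z.
pose q (s : R) : R[i] := k * (0 + z * s%:C) ^+ 2 + b * (0 + z * s%:C).
pose g (s : R) : R[i] := f (0 + z * s%:C) * expC (- q s).
have dg s : rdiff g s 0.
  have dq : rdiff (fun s => - q s) s (- ((2 * k * (0 + z * s%:C) + b) * z)).
    have := rdiffZ (-1) (rdiff_quadratic k b 0 z s).
    by rewrite mulN1r; congr rdiff; apply/funext => u; rewrite mulN1r.
  apply: rdiff_eq (rdiffM (cdiff_rdiff (hf _) (rdiff_line 0 z s)) (rdiff_expC dq)) _.
  rewrite /comp ode; ring.
have := rdiff_unique 0 1 dg (rdiff_cst 0); rewrite subrr => /eqP.
rewrite subr_eq0 /g /q !mulr0 !mulr1 !add0r expr0n /= mulr0 mulr0 addr0 oppr0 expC0 mulr1 => /eqP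
  <-.
by rewrite -mulrA expCNK mulr1.
Qed.

Lemma cderive_gaussian (R : realType) (f : R[i] -> R[i]) (k b C : R[i]) : entire f ->
  (forall z, f z = C * expC (k * z ^+ 2 + b * z)) ->
  forall z, cderive f z = (2 * k * z + b) * f z.
Proof.
move=> ef hf z; have df := entire_cdiff ef.
have d1 := cdiff_rdiff (df (z + 1 * 0%:C)) (rdiff_line z 1 0).
have := rdiffZ C (rdiff_expC (rdiff_quadratic k b z 1 0)).
rewrite (_ : (fun s => _) = f \o (fun s : R => z + 1 * s%:C)); last first.
  by apply/funext => s; rewrite /= hf.
move=> /(rdiff_lim_unique d1).
rewrite mulr0 addr0 !mulr1 => ->; rewrite hf; ring.
Qed.

(** * Gaussian integrands *)

Lemma fock_integrand_nrm (R : realType) (h : R[i] -> R[i]) (p : plane R) :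
  fock_integrand h p = nrm (h (p.1 +i* p.2)) ^+ 2 * gauss_weight p.
Proof. by rewrite sqr_nrm /fock_integrand /plane_re /plane_im !expr2. Qed.

Lemma fock_integrand_gaussian (R : realType) (f : R[i] -> R[i]) (k : R) (b C : R[i]) :
  (forall z, f z = C * expC (k%:C * z ^+ 2 + b * z)) -> forall x y : R,
  fock_integrand f (x, y) = nrm C ^+ 2 * (pi^-1 *
    expR ((- ((1 - 2 * k) * (x * x)) + 2 * re b * x) +
          (- ((1 + 2 * k) * (y * y)) + - (2 * im b) * y))).
Proof.
move=> hf x y; rewrite fock_integrand_nrm hf nrmM nrm_expC exprMn -[LHS]mulrA; congr (_ * _).
rewrite /gauss_weight mulrCA; congr (_ * _).
rewrite -expRM_natl -expRD; congr expR.
by case: b {hf} => b1 b2; rewrite expr2 /=; ring.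
Qed.

Lemma lebesgue_measureT (R : realType) : @lebesgue_measure R [set: R] = +oo%E.
Proof. by rewrite -set_itvNyy lebesgue_measure_itv. Qed.

Lemma integral_eq_pinfty (R : realType) (S : set (plane R)) (h : R * R -> R) (d : R) :
  measurable S -> area R S = +oo%E -> 0 < d -> cts_fun h -> (forall p, 0 <= h p) ->
  (forall p, S p -> d <= h p) -> (\int[area R]_p (h p)%:E = +oo)%E.
Proof.
move=> mS S_oo d0 ch h0 dh; apply/eqP; rewrite -leye_eq.
have mh : measurable_fun [set: plane R] (EFin \o (h : plane R -> R)).
  by apply/measurable_EFinP; exact: (continuous_measurable_plane ch).
apply: (@le_trans _ _ (\int[area R]_(p in S) (h p)%:E)%E); last first.
  by apply: ge0_subset_integral => // q _; rewrite lee_fin.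
apply: (@le_trans _ _ (\int[area R]_(p in S) d%:E)%E).
  have -> : (\int[area R]_(p in S) d%:E = d%:E * area R S)%E by exact: integral_cst.
  by rewrite S_oo mulry gtr0_sg// mul1e.
apply: ge0_le_integral => //.
- by move=> q _; rewrite lee_fin ltW.
- exact: measurable_funTS.
Qed.

Lemma area_vertical_strip (R : realType) : area R (`[0%R, 1%R] `*` setT) = +oo%E.
Proof.
rewrite area_setX//.
rewrite lebesgue_measure_itv/= lte_fin ltr01 lebesgue_measureT oppr0 adde0 mul1e//.
Qed.

Lemma area_horizontal_strip (R : realType) : area R (setT `*` `[0%R, 1%R]) = +oo%E.
Proof.
rewrite area_setX//.
rewrite lebesgue_measure_itv/= lte_fin ltr01 lebesgue_measureT oppr0 adde0 mule1//.
Qed.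

(** For f = C exp (- z^2 / 2 + a z) the weight cancels the growth in y: the
    integrand is at least a positive constant on a vertical strip, whose area is
    infinite. *)
Lemma position_op_inj (R : realType) (f : R[i] -> R[i]) (a : R) : entire f ->
  (\int[area R]_p (fock_integrand f p)%:E < +oo)%E ->
  (forall z, position_op f a z = 0) -> forall z, f z = 0.
Proof.
move=> ef If u0.
have H := @linear_ode_gaussian _ f (cderive f) (- 2^-1)%:C a%:C (entire_cdiff ef) _.
have {H} fE z : f z = f 0 * expC ((- 2^-1)%:C * z ^+ 2 + a%:C * z).
  apply: H => {}z; have /eqP := u0 z; rewrite /position_op subr_eq0 => /eqP.
  by move=> /(congr1 (fun x => x - z * f z)); rewrite addrK => ->;
    rewrite rmorphN fmorphV rmorph_nat; field.
have [f0|f0] := eqVneq (f 0) 0; first by move=> z; rewrite fE f0 mul0r.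
exfalso; move: If; rewrite (@integral_eq_pinfty _ (`[0, 1]%classic `*` setT) _
  (nrm (f 0) ^+ 2 * (pi^-1 * expR (- 2 - 2 * `|a|)))) //.
- by apply: measurableX => //; exact: measurable_itv.
- exact: area_vertical_strip.
- apply: mulr_gt0; last by rewrite mulr_gt0 ?expR_gt0 ?invr_gt0 ?pi_gt0.
  by rewrite exprn_gt0// lt_neqAle nrm_ge0 andbT eq_sym nrm_eq0.
- exact: (continuous_fock_integrand (cdiff_ccts (entire_cdiff ef))).
- exact: fock_integrand_ge0.
move=> [x y] [/=]; rewrite in_itv /= => /andP[x0 x1] _.
rewrite (fock_integrand_gaussian fE) ler_wpM2l ?sqr_ge0// ler_wpM2l ?invr_ge0 ?pi_ge0//.
rewrite ler_expR /=; have := ler_norm a; have := ler_norm (- a); rewrite normrN.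
by nra.
Qed.

(** As for [position_op_inj], with the coordinates exchanged. *)
Lemma momentum_op_inj (R : realType) (f : R[i] -> R[i]) (b : R) : entire f ->
  (\int[area R]_p (fock_integrand f p)%:E < +oo)%E ->
  (forall z, momentum_op f b z = 0) -> forall z, f z = 0.
Proof.
move=> ef If u0.
have H := @linear_ode_gaussian _ f (cderive f) (2^-1)%:C ('i%C * b%:C) (entire_cdiff ef) _.
have {H} fE z : f z = f 0 * expC ((2^-1)%:C * z ^+ 2 + 'i%C * b%:C * z).
  apply: H => {}z; have /eqP := u0 z; rewrite /momentum_op subr_eq0 => /eqP.
  by move=> /(congr1 (fun x => x + z * f z)); rewrite subrK => ->; rewrite fmorphV rmorph_nat;
    field.
have [f0|f0] := eqVneq (f 0) 0; first by move=> z; rewrite fE f0 mul0r.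
exfalso; move: If; rewrite (@integral_eq_pinfty _ (setT `*` `[0, 1]%classic) _
  (nrm (f 0) ^+ 2 * (pi^-1 * expR (- 2 - 2 * `|b|)))) //.
- by apply: measurableX => //; exact: measurable_itv.
- exact: area_horizontal_strip.
- apply: mulr_gt0; last by rewrite mulr_gt0 ?expR_gt0 ?invr_gt0 ?pi_gt0.
  by rewrite exprn_gt0// lt_neqAle nrm_ge0 andbT eq_sym nrm_eq0.
- exact: (continuous_fock_integrand (cdiff_ccts (entire_cdiff ef))).
- exact: fock_integrand_ge0.
move=> [x y] [/= _]; rewrite in_itv /= => /andP[y0 y1].
rewrite (fock_integrand_gaussian fE) ler_wpM2l ?sqr_ge0// ler_wpM2l ?invr_ge0 ?pi_ge0//.
rewrite ler_expR /=; have := ler_norm b; have := ler_norm (- b); rewrite normrN.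
by nra.
Qed.

(** A quarter of the exponent absorbs 1 + x^2 and a quarter the linear term; the
    remaining half is a multiple of a normal density. *)
Lemma poly_gauss_bound (R : realType) (p r : R) : 0 < p ->
  exists K s : R, [/\ 0 < K, s != 0 &
    forall x, (1 + x * x) * expR (- (p * (x * x)) + r * x) <= K * normal_pdf 0 s x].
Proof.
move=> p0; pose s := Num.sqrt p^-1.
have s2 : s ^+ 2 = p^-1 by rewrite sqr_sqrtr// invr_ge0 ltW.
have s0 : s != 0 by rewrite sqrtr_eq0 -ltNge invr_gt0.
have pk := normal_peak_gt0 s0.
exists ((1 + 4 / p) * expR (r ^+ 2 / p) / normal_peak s), s; split => //.
  by rewrite divr_gt0// mulr_gt0 ?expR_gt0// addr_gt0// divr_gt0.
move=> x; rewrite normal_pdfE//= [leRHS]mulrA divfK ?gt_eqF// /normal_fun subr0 s2.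
rewrite -mulrA -expRD.
have h1 : 1 + x * x <= (1 + 4 / p) * expR (p * (x * x) / 4).
  have := expR_ge1Dx (p * (x * x) / 4).
  have xx : 0 <= x * x by rewrite -expr2 sqr_ge0.
  have p4 : 0 < 4 / p by rewrite divr_gt0.
  have e : 4 / p * (p * (x * x) / 4) = x * x by field; lra.
  move=> h; apply: (@le_trans _ _ ((1 + 4 / p) * (1 + p * (x * x) / 4))); last first.
    by rewrite ler_wpM2l// addr_ge0// ltW.
  rewrite mulrDl mul1r mulrDr mulr1 e.
  have : 0 <= p * (x * x) / 4 by rewrite divr_ge0// mulr_ge0// ltW.
  lra.
apply: (@le_trans _ _ ((1 + 4 / p) * expR (p * (x * x) / 4) * expR (- (p * (x * x)) + r * x))).
  by rewrite ler_wpM2r ?expR_ge0.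
rewrite -mulrA -expRD ler_wpM2l ?addr_ge0 ?divr_ge0 ?(ltW p0)// ler_expR.
have -> : - x ^+ 2 / (p^-1 *+ 2) = - (p * (x * x)) / 2 by field; lra.
have : 0 <= p * (x / 2 - r / p) ^+ 2 by rewrite mulr_ge0 ?sqr_ge0// ltW.
have -> : p * (x / 2 - r / p) ^+ 2 = p * (x * x) / 4 - r * x + r ^+ 2 / p by field; lra.
lra.
Qed.

Lemma integral_lty_of_normal_bound (R : realType) (h : R * R -> R) (K s t : R) : 0 <= K ->
  cts_fun h -> (forall p, 0 <= h p) ->
  s != 0 -> t != 0 ->
  (forall x y, h (x, y) <= K * (normal_pdf 0 s x * normal_pdf 0 t y)) ->
  (\int[area R]_p (h p)%:E < +oo)%E.
Proof.
move=> K0 ch h0 s0 t0 hle.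
have mh : measurable_fun [set: plane R] (EFin \o (h : plane R -> R)).
  by apply/measurable_EFinP; exact: (continuous_measurable_plane ch).
have sec (x : R) : measurable_fun [set: measurableTypeR R] (EFin \o ((fun y => h (x, y)) : R -> R)).
  have c : continuous (fun y => h (x, y)) := continuous_section2 ch.
  by apply/measurable_EFinP; exact: (continuous_measurable_fun c).
rewrite (fubini_tonelli1 _ mh) => [|p]; last by rewrite lee_fin.
apply: (@le_lt_trans _ _ (\int[@lebesgue_measure R]_x (K%:E * (normal_pdf 0 s x)%:E))%E).
  apply: ge0_le_integral => //.
  - by move=> x _; apply: integral_ge0 => y _; rewrite lee_fin.
  - exact: (measurable_fun_fubini_tonelli_F _ mh).
  - apply: measurable_funeM; apply/measurable_EFinP; exact: measurable_normal_pdf.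
  - move=> x _; rewrite /fubini_F /=.
    apply: (@le_trans _ _ (\int[@lebesgue_measure R]_y ((K * normal_pdf 0 s x)%:E * (normal_pdf 0
      t y)%:E))%E).
      apply: ge0_le_integral => //.
      + by move=> y _; rewrite lee_fin.
      + exact: sec.
      + apply: measurable_funeM; apply/measurable_EFinP; exact: measurable_normal_pdf.
      + by move=> y _; rewrite -EFinM lee_fin -mulrA.
    rewrite ge0_integralZl//.
    + by rewrite integral_normal_pdf mule1 EFinM.
    + by apply/measurable_EFinP; exact: measurable_normal_pdf.
    + by move=> y _; rewrite lee_fin normal_pdf_ge0.
    + by rewrite lee_fin mulr_ge0// normal_pdf_ge0.
rewrite ge0_integralZl//.
- by rewrite integral_normal_pdf mule1 ltry.
- by apply/measurable_EFinP; exact: measurable_normal_pdf.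
- by move=> y _; rewrite lee_fin normal_pdf_ge0.
Qed.

(** The condition on k says that |f|^2 w decays in both coordinates. *)
Lemma linear_gaussian_lty (R : realType) (f v : R[i] -> R[i]) (k : R) (b C m n : R[i]) :
  -1 < 2 * k < 1 ->
  (forall z, f z = C * expC (k%:C * z ^+ 2 + b * z)) ->
  (forall z, v z = (m * z + n) * f z) -> ccts v ->
  (\int[area R]_p (fock_integrand v p)%:E < +oo)%E.
Proof.
move=> /andP[k1 k2] hf hv cv.
have q1 : 0 < 1 - 2 * k by lra.
have q2 : 0 < 1 + 2 * k by lra.
have [K1 [s [K10 s0 h1]]] := poly_gauss_bound (2 * re b) q1.
have [K2 [t [K20 t0 h2]]] := poly_gauss_bound (- (2 * im b)) q2.
pose M := 2 * (nrm m ^+ 2 + nrm n ^+ 2).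
have M0 : 0 <= M by rewrite mulr_ge0// addr_ge0// sqr_ge0.
have P0 : 0 <= nrm C ^+ 2 * pi^-1 by rewrite mulr_ge0 ?sqr_ge0// invr_ge0 pi_ge0.
apply: (@integral_lty_of_normal_bound _ _ (M * (nrm C ^+ 2 * pi^-1) * (K1 * K2)) s t) => //.
- by apply: mulr_ge0; [exact: mulr_ge0|rewrite mulr_ge0// ltW].
- exact: (continuous_fock_integrand cv).
- exact: fock_integrand_ge0.
move=> x y.
have -> : fock_integrand v (x, y) = nrm (m * (x +i* y) + n) ^+ 2 * fock_integrand f (x, y).
  by rewrite !fock_integrand_nrm hv nrmM exprMn mulrA.
rewrite (fock_integrand_gaussian hf) expRD.
set e1 := expR _; set e2 := expR _.
have xx : 0 <= x * x by rewrite -expr2 sqr_ge0.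
have yy : 0 <= y * y by rewrite -expr2 sqr_ge0.
have xy : 0 <= x * x * (y * y) by exact: mulr_ge0.
have lin : nrm (m * (x +i* y) + n) ^+ 2 <= M * ((1 + x * x) * (1 + y * y)).
  apply: (@le_trans _ _ ((nrm m * nrm (x +i* y) + nrm n) ^+ 2)).
    rewrite ler_sqr ?nnegrE ?nrm_ge0 ?addr_ge0 ?mulr_ge0 ?nrm_ge0//.
    by apply: le_trans (ler_nrmD _ _) _; rewrite nrmM.
  apply: (@le_trans _ _ (2 * ((nrm m * nrm (x +i* y)) ^+ 2 + nrm n ^+ 2))).
    by have := sqr_ge0 (nrm m * nrm (x +i* y) - nrm n); rewrite sqrrB sqrrD; lra.
  have sz : nrm (x +i* y) ^+ 2 = x * x + y * y by rewrite sqr_nrm /= !expr2.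
  rewrite /M -mulrA ler_wpM2l// exprMn sz mulrDl; apply: lerD.
    by rewrite ler_wpM2l ?sqr_ge0//; lra.
  by rewrite ler_peMr ?sqr_ge0//; lra.
apply: (@le_trans _ _ (M * ((1 + x * x) * (1 + y * y)) * (nrm C ^+ 2 * (pi^-1 * (e1 * e2))))).
  have ee : 0 <= pi^-1 * (e1 * e2).
    by apply: mulr_ge0; [rewrite invr_ge0 pi_ge0|rewrite mulr_ge0// expR_ge0].
  by rewrite ler_wpM2r//; apply: mulr_ge0 => //; exact: sqr_ge0.
rewrite (_ : _ * _ = M * (nrm C ^+ 2 * pi^-1) * (((1 + x * x) * e1) * ((1 + y * y) * e2)));
  last by ring.
rewrite -[leRHS]mulrA ler_wpM2l//; first exact: mulr_ge0.
rewrite (_ : K1 * K2 * _ = (K1 * normal_pdf 0 s x) * (K2 * normal_pdf 0 t y)); last by ring.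
by apply: ler_pM; rewrite ?h1 ?h2// mulr_ge0 ?expR_ge0// addr_ge0.
Qed.

(** * The uncertainty inequality and its extremals *)

Lemma cctsP (R : realType) (f : R[i] -> R[i]) :
  ccts f <-> cts_fun (plane_re f) /\ cts_fun (plane_im f).
Proof.
split=> [|[c1 c2] [x y] e e0]; first exact: continuous_plane.
have e20 : 0 < e / 2 by lra.
have /cvgrPdist_le/(_ _ e20)/nbhs_ballP[d1 /= d10 hd1] := c1 (x, y).
have /cvgrPdist_le/(_ _ e20)/nbhs_ballP[d2 /= d20 hd2] := c2 (x, y).
exists (Num.min d1 d2); first by rewrite lt_min d10.
move=> [p q]; rewrite lt_min => /andP[hp hq].
have b (d : R) : nrm (p +i* q) < d -> ball (x, y) d (x + p, y + q).
  move=> hd; split; rewrite -ball_normE /= opprD addNKr normrN.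
    exact: le_lt_trans (ler_Re_nrm (p +i* q)) hd.
  exact: le_lt_trans (ler_Im_nrm (p +i* q)) hd.
have := hd1 _ (b _ hp); have := hd2 _ (b _ hq); rewrite /plane_re /plane_im /= => k2 k1.
rewrite -[(x +i* y) + _]/((x + p) +i* (y + q)) nrmB; apply: le_trans (ler_nrm_ReIm _) _.
move: k1 k2; case: (f _) => ? ?; case: (f _) => ? ? /=; lra.
Qed.

Lemma ccts_position_op (R : realType) (f : R[i] -> R[i]) (a : R) : entire f ->
  ccts (position_op f a).
Proof.
move=> ef; have ef1 := entire_cderive ef.
have [c1 c2] := continuous_plane (cdiff_ccts (entire_cdiff ef)).
have [d1 d2] := continuous_plane (cdiff_ccts (entire_cdiff ef1)).
apply/cctsP; split.
  rewrite (_ : plane_re _ = fun p => plane_re (cderive f) p +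
      (p.1 * plane_re f p - p.2 * plane_im f p) - a * plane_re f p); first by cts.
  by apply/funext => p; rewrite /position_op /plane_re /plane_im; case: (f _) => ? ?;
    case: (cderive _ _) => ? ? /=; ring.
rewrite (_ : plane_im _ = fun p => plane_im (cderive f) p +
    (p.1 * plane_im f p + p.2 * plane_re f p) - a * plane_im f p); first by cts.
by apply/funext => p; rewrite /position_op /plane_re /plane_im; case: (f _) => ? ?;
  case: (cderive _ _) => ? ? /=; ring.
Qed.

Lemma ccts_momentum_op (R : realType) (f : R[i] -> R[i]) (b : R) : entire f ->
  ccts (momentum_op f b).
Proof.
move=> ef; have ef1 := entire_cderive ef.
have [c1 c2] := continuous_plane (cdiff_ccts (entire_cdiff ef)).
have [d1 d2] := continuous_plane (cdiff_ccts (entire_cdiff ef1)).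
apply/cctsP; split.
  rewrite (_ : plane_re _ = fun p => plane_re (cderive f) p -
      (p.1 * plane_re f p - p.2 * plane_im f p) + b * plane_im f p); first by cts.
  by apply/funext => p; rewrite /momentum_op /plane_re /plane_im; case: (f _) => ? ?;
    case: (cderive _ _) => ? ? /=; ring.
rewrite (_ : plane_im _ = fun p => plane_im (cderive f) p -
    (p.1 * plane_im f p + p.2 * plane_re f p) - b * plane_re f p); first by cts.
by apply/funext => p; rewrite /momentum_op /plane_re /plane_im; case: (f _) => ? ?;
  case: (cderive _ _) => ? ? /=; ring.
Qed.

Lemma fock_integrand_eq0 (R : realType) (h : R[i] -> R[i]) : ccts h ->
  (\int[area R]_p (fock_integrand h p)%:E = 0)%E -> forall z, h z = 0.
Proof.
move=> ch h0 [x y].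
have := continuous_integral_eq0 (continuous_fock_integrand ch) (@fock_integrand_ge0 R h) h0 (x, y).
rewrite fock_integrand_nrm => /eqP; rewrite mulf_eq0 (gt_eqF (gauss_weight_gt0 _)) orbF.
by rewrite expf_eq0 /= nrm_eq0 => /eqP.
Qed.

Lemma integral_fock_integrand_ge0 (R : realType) (h : R[i] -> R[i]) :
  (0 <= \int[area R]_p (fock_integrand h p)%:E)%E.
Proof. by apply: integral_ge0 => p _; rewrite lee_fin fock_integrand_ge0. Qed.

Lemma continuous_fock_cross (R : realType) (u v : R[i] -> R[i]) : ccts u -> ccts v ->
  cts_fun (fock_cross u v : R * R -> R).
Proof.
move=> /continuous_plane[c1 c2] /continuous_plane[d1 d2]; have cw := @continuous_gauss_weight R.
by rewrite /fock_cross; cts.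
Qed.

Lemma integrable_fock_cross (R : realType) (u v : R[i] -> R[i]) : ccts u -> ccts v ->
  (area R).-integrable setT (EFin \o fock_integrand u) ->
  (area R).-integrable setT (EFin \o fock_integrand v) ->
  (area R).-integrable setT (EFin \o fock_cross u v).
Proof.
move=> cu cv iu iv.
apply: (le_integrable measurableT _ _ (integrableD measurableT iu iv)).
  by apply/measurable_EFinP; exact: (continuous_measurable_plane (continuous_fock_cross cu cv)).
move=> p _; rewrite lee_fin; apply: le_trans (ler_norm _).
have w0 : 0 <= gauss_weight p by rewrite ltW// gauss_weight_gt0.
rewrite /fock_cross /fock_integrand -mulrDl normrM (ger0_norm w0) ler_wpM2r//.
have := ler_norm_dot (plane_re u p) (plane_im u p) (plane_re v p) (plane_im v p).
have := normr_ge0 (plane_re u p * plane_re v p + plane_im u p * plane_im v p); lra.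
Qed.

Lemma fock_integrand_addZ (R : realType) (u v : R[i] -> R[i]) (t : R) (p : plane R) :
  fock_integrand (fun z => u z + t%:C * v z) p =
  fock_integrand u p + ((2 * t) * fock_cross u v p + (t * t) * fock_integrand v p).
Proof.
rewrite /fock_integrand /fock_cross /plane_re /plane_im.
by case: (u _) => ? ?; case: (v _) => ? ? /=; ring.
Qed.

Lemma ccts_addZ (R : realType) (u v : R[i] -> R[i]) (t : R) : ccts u -> ccts v ->
  ccts (fun z => u z + t%:C * v z).
Proof.
move=> /cctsP[c1 c2] /cctsP[d1 d2]; apply/cctsP; split.
  rewrite (_ : plane_re _ = fun p => plane_re u p + t * plane_re v p); first by cts.
  by apply/funext => p; rewrite /plane_re; case: (u _) => ? ?; case: (v _) => ? ? /=; ring.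
rewrite (_ : plane_im _ = fun p => plane_im u p + t * plane_im v p); first by cts.
by apply/funext => p; rewrite /plane_im; case: (u _) => ? ?; case: (v _) => ? ? /=; ring.
Qed.

Lemma fock_uncertainty_finite (R : realType) (f : R[i] -> R[i]) (a b A B N : R) : entire f ->
  let u := position_op f a in let v := momentum_op f b in
  (\int[area R]_p (fock_integrand f p)%:E = N%:E)%E ->
  (\int[area R]_p (fock_integrand u p)%:E = A%:E)%E ->
  (\int[area R]_p (fock_integrand v p)%:E = B%:E)%E ->
  (\int[area R]_p (fock_cross u v p)%:E = (- N)%:E)%E /\
  forall t : R,
  (\int[area R]_p (fock_integrand (fun z => u z + t%:C * v z) p)%:E =
   (A - 2 * t * N + t * t * B)%:E)%E.
Proof.
move=> ef u v IN IA IB.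
have cf := cdiff_ccts (entire_cdiff ef).
have cu : ccts u by exact: ccts_position_op.
have cv : ccts v by exact: ccts_momentum_op.
have if_ := integrable_fock_integrand cf (eq_ind_r (fun x => (x < +oo)%E) (ltry N) IN).
have iu := integrable_fock_integrand cu (eq_ind_r (fun x => (x < +oo)%E) (ltry A) IA).
have iv := integrable_fock_integrand cv (eq_ind_r (fun x => (x < +oo)%E) (ltry B) IB).
have ix := integrable_fock_cross cu cv iu iv.
have X : (\int[area R]_p (fock_cross u v p)%:E = (- N)%:E)%E.
  have := @fock_commutator R f a b ef cu cv; rewrite IN IA IB !ltry => /(_ isT isT isT).
  rewrite (_ : (fun p => _) = ((EFin \o fock_cross u v) \+ (EFin \o fock_integrand f))%E);
    last first.
    by apply/funext => p; rewrite EFinD.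
  rewrite integralD//= IN; case: (integral _ _ _) => [r||]//=.
  by rewrite -EFinD => -[] h; congr EFin; lra.
split=> // t.
rewrite (_ : (fun p => _) = ((EFin \o fock_integrand u) \+
   ((fun p => (2 * t)%:E * (EFin \o fock_cross u v) p) \+ (fun p => (t * t)%:E * (EFin \o
     fock_integrand v) p)))%E); last first.
  by apply/funext => p; rewrite fock_integrand_addZ !EFinD !EFinM.
have i1 := integrableZl measurableT (2 * t) ix; have i2 := integrableZl measurableT (t * t) iv.
rewrite integralD//; last exact: integrableD.
rewrite integralD// !integralZl//=.
by rewrite IA X IB -!EFinM -!EFinD; congr EFin; ring.
Qed.

(** If f is not zero, neither is the norm of u or v, so that an infinite norm
    makes the product infinite.  Otherwise the quadratic polynomial of
    [fock_uncertainty_finite] is evaluated at its minimum t = N / B. *)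
Lemma fock_uncertainty (R : realType) (f : R[i] -> R[i]) (a b : R) : entire f ->
  let u := position_op f a in let v := momentum_op f b in
  (fock_norm f < +oo)%E ->
  (fock_norm f ^+ 2 <= fock_norm u * fock_norm v)%E /\
  ((fock_norm u * fock_norm v = fock_norm f ^+ 2)%E -> (forall z, f z = 0) \/
   exists2 c : R, 0 < c & forall z, u z + c%:C * v z = 0).
Proof.
move=> ef u v; rewrite !fock_normE => If.
have cf := cdiff_ccts (entire_cdiff ef).
have cu : ccts u by exact: ccts_position_op.
have cv : ccts v by exact: ccts_momentum_op.
have f0 := integral_fock_integrand_ge0 f.
have u0 := integral_fock_integrand_ge0 u.
have v0 := integral_fock_integrand_ge0 v.
rewrite sqr_sqrte//.
case EN : (integral (area R) setT (fun p => (fock_integrand f p)%:E)) => [N||]; last 2 first.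
- by rewrite EN in If.
- by rewrite EN in f0.
have Ify : (\int[area R]_p (fock_integrand f p)%:E < +oo)%E by rewrite EN ltry.
rewrite EN lee_fin in f0.
have [N0|N0] := eqVneq N 0.
  rewrite N0; split; first by rewrite mule_ge0// sqrte_ge0.
  by move=> _; left; apply: fock_integrand_eq0 => //; rewrite EN N0.
have Npos : 0 < N by rewrite lt_neqAle eq_sym N0.
have fn0 : ~ (forall z, f z = 0).
  move=> h; move: N0; rewrite -eqe -EN; apply/negP; rewrite negbK; apply/eqP.
  by apply: integral0_eq => p _; rewrite /fock_integrand /plane_re /plane_im h /= mul0r addr0 mul0r.
have un0 : (\int[area R]_p (fock_integrand u p)%:E != 0)%E.
  by apply/eqP => h; apply: fn0; apply: (position_op_inj ef Ify (fock_integrand_eq0 cu h)).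
have vn0 : (\int[area R]_p (fock_integrand v p)%:E != 0)%E.
  by apply/eqP => h; apply: fn0; apply: (momentum_op_inj ef Ify (fock_integrand_eq0 cv h)).
case EA : (integral (area R) setT (fun p => (fock_integrand u p)%:E)) => [A||]; last first.
- by rewrite EA in u0.
- rewrite /= gt0_mulye; last by rewrite lt_neqAle eq_sym sqrte_ge0 andbT -(sqrte0 R);
  case: (integral _ _ _) v0 vn0 => [r||]//=; rewrite lee_fin eqe sqrtr0 => r0 rn;
  rewrite eqe sqrtr_eq0 -ltNge lt_neqAle eq_sym rn.
  by split => //; rewrite leey.
case EB : (integral (area R) setT (fun p => (fock_integrand v p)%:E)) => [B||]; last first.
- by rewrite EB in v0.
- rewrite EA in u0 un0; rewrite /= gt0_muley; last first.
    by rewrite lte_fin sqrtr_gt0 lt_neqAle eq_sym -eqe un0.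
  by split => //; rewrite leey.
rewrite EA eqe lee_fin in u0 un0; rewrite EB eqe lee_fin in v0 vn0.
have Bpos : 0 < B by rewrite lt_neqAle eq_sym vn0.
have [_ quad] := fock_uncertainty_finite ef EN EA EB.
have E t : t = N / B -> A - 2 * t * N + t * t * B = A - N ^+ 2 / B by move=> ->; field.
have q0 : N ^+ 2 <= A * B.
  have := integral_fock_integrand_ge0 (fun z => u z + (N / B)%:C * v z).
  by rewrite quad E// lee_fin subr_ge0 ler_pdivrMr.
rewrite /= -EFinM -sqrtrM// lee_fin; split.
  by rewrite -[leLHS]ger0_norm// -sqrtr_sqr ler_wsqrtr.
move=> -[] /(congr1 (fun x => x ^+ 2)); rewrite sqr_sqrtr ?mulr_ge0// => AB.
right; exists (N / B); first by rewrite divr_gt0.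
apply: fock_integrand_eq0; first exact: ccts_addZ.
by rewrite quad E// -AB mulfK ?gt_eqF// subrr.
Qed.

Lemma gaussian_coefficient_real (R : realType) (c : R) : 0 < c ->
  2 * ((c - 1) / (2 * (c + 1))) = (c - 1) / (c + 1).
Proof. by move=> c0; field; lra. Qed.

Lemma gaussian_coefficient (R : realType) (c : R) : 0 < c ->
  2 * ((c - 1) / (2 * (c + 1)))%:C = (c%:C - 1) / (c%:C + 1) :> R[i].
Proof.
move=> c0; rewrite -(rmorph_nat (real_complex R) 2) -rmorphM.
by rewrite gaussian_coefficient_real// fmorph_div rmorphB rmorphD rmorph1.
Qed.

(** For these f one has u = - c v, so A = c^2 B, and Re <u, v> = - N becomes
    c B = N. *)
Lemma gaussian_minimizes (R : realType) (f : R[i] -> R[i]) (a b c : R) (C : R[i]) :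
  entire f -> (fock_norm f < +oo)%E -> 0 < c ->
  (forall z, f z = C * expC (((c - 1) / (2 * (c + 1)))%:C * z ^+ 2 +
     (a%:C + 'i%C * b%:C * c%:C) / (c + 1)%:C * z)) ->
  (fock_norm (position_op f a) * fock_norm (momentum_op f b) = fock_norm f ^+ 2)%E.
Proof.
move=> ef; rewrite !fock_normE => If c0 fE.
set k := (c - 1) / (2 * (c + 1)) in fE; set d := (_ / _)%R in fE.
pose u := position_op f a; pose v := momentum_op f b.
have c1 : (c + 1)%:C != 0 :> R[i] by rewrite -nrm_eq0 nrmR normr_eq0 gt_eqF//; lra.
have c1' : c%:C + 1 != 0 :> R[i] by move: c1; rewrite rmorphD.
have kE : 2 * k%:C = (c%:C - 1) / (c%:C + 1) :> R[i].
  exact: gaussian_coefficient.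
have dE : d = (a%:C + 'i%C * b%:C * c%:C) / (c%:C + 1) by rewrite /d rmorphD.
have df := cderive_gaussian ef fE.
have vE z : v z = (- 2 / (c%:C + 1) * z + (a%:C - 'i%C * b%:C) / (c%:C + 1)) * f z.
  rewrite /v /momentum_op df kE dE; field; exact: c1'.
have uv z : u z = - c%:C * v z.
  rewrite vE /u /position_op df kE dE; field; exact: c1'.
have uE z : u z = (- c%:C * (- 2 / (c%:C + 1))
  * z + - c%:C * ((a%:C - 'i%C * b%:C) / (c%:C + 1))) * f z.
  by rewrite uv vE; ring.
have k1 : -1 < 2 * k < 1.
  rewrite /k gaussian_coefficient_real//.
  by apply/andP; split; [rewrite ltr_pdivlMr|rewrite ltr_pdivrMr]; lra.
have Iu := linear_gaussian_lty k1 fE uE (ccts_position_op a ef).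
have Iv := linear_gaussian_lty k1 fE vE (ccts_momentum_op b ef).
have f0 := integral_fock_integrand_ge0 f.
have u0 := integral_fock_integrand_ge0 u.
have v0 := integral_fock_integrand_ge0 v.
rewrite sqr_sqrte//.
case EN : (integral (area R) setT (fun p => (fock_integrand f p)%:E)) => [N||]; last 2 first.
- by rewrite EN in If.
- by rewrite EN in f0.
case EA : (integral (area R) setT (fun p => (fock_integrand u p)%:E)) => [A||]; last 2 first.
- by rewrite EA in Iu.
- by rewrite EA in u0.
case EB : (integral (area R) setT (fun p => (fock_integrand v p)%:E)) => [B||]; last 2 first.
- by rewrite EB in Iv.
- by rewrite EB in v0.
rewrite EB lee_fin in v0.
have [X _] := fock_uncertainty_finite ef EN EA EB.
have iv : (area R).-integrable setT (EFin \o fock_integrand v) :=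
  integrable_fock_integrand (ccts_momentum_op b ef) Iv.
have XE : (\int[area R]_p (fock_cross u v p)%:E = (- c * B)%:E)%E.
  rewrite (_ : (fun p => _) = (fun p => (- c)%:E * (EFin \o fock_integrand v) p)%E); last first.
    apply/funext => p; rewrite /= -EFinM; congr EFin.
    by rewrite /fock_cross /fock_integrand /plane_re /plane_im uv; case: (v _) => ? ? /=; ring.
  by rewrite integralZl//= EB EFinM.
have AE : A = c ^+ 2 * B.
  apply: EFin_inj; rewrite -EA EFinM -EB.
  rewrite -[RHS](@integralZl _ _ _ _ _ measurableT _ iv); apply: eq_integral => p _.
  rewrite /= -EFinM; congr EFin.
  by rewrite /fock_integrand /plane_re /plane_im uv; case: (v _) => ? ? /=; ring.
have NE : N = c * B by move: X; rewrite XE => -[]; lra.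
rewrite /= -EFinM AE NE sqrtrM ?sqr_ge0// sqrtr_sqr ger0_norm ?(ltW c0)//.
by rewrite -mulrA -expr2 sqr_sqrtr.
Qed.

Lemma minimizer_gaussian (R : realType) (f : R[i] -> R[i]) (a b c : R) : entire f -> 0 < c ->
  (forall z, position_op f a z + c%:C * momentum_op f b z = 0) ->
  forall z, f z = f 0 * expC (((c - 1) / (2 * (c + 1)))%:C * z ^+ 2 +
     (a%:C + 'i%C * b%:C * c%:C) / (c + 1)%:C * z).
Proof.
move=> ef c0 H.
have c1 : (c + 1)%:C != 0 :> R[i] by rewrite -nrm_eq0 nrmR normr_eq0 gt_eqF//; lra.
have c1' : c%:C + 1 != 0 :> R[i] by move: c1; rewrite rmorphD.
apply: (linear_ode_gaussian (entire_cdiff ef)) => z.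
rewrite gaussian_coefficient// rmorphD /=; apply: (@mulfI _ (c%:C + 1)) => //.
have := H z; rewrite /position_op /momentum_op => h.
rewrite -[LHS]subr0 -[X in _ - X]h; field; exact: c1'.
Qed.

Theorem theorem4 (R : realType) (f : R[i] -> R[i]) (hf : fock_space f) :
  (forall a b : R,
     (fock_norm (fun z => cderive f z + z * f z - a%:C * f z)%R *
      fock_norm (fun z => cderive f z - z * f z - 'i%C * b%:C * f z)%R
        >= fock_norm f ^+ 2)%E) /\
  (forall a b : R,
     (fock_norm (fun z => cderive f z + z * f z - a%:C * f z)%R *
      fock_norm (fun z => cderive f z - z * f z - 'i%C * b%:C * f z)%R
        = fock_norm f ^+ 2)%E <->
     exists (c : R) (C : R[i]), 0 < c /\
       forall z : R[i],
         f z = C * expC (((c - 1) / (2 * (c + 1)))%:C * z ^+ 2 +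
                         (a%:C + 'i%C * b%:C * c%:C) / (c + 1)%:C * z)).
Proof.
have [ef nf] := hf; split=> a b; first by have [] := fock_uncertainty a b ef nf.
split=> [|[c [C [c0 fE]]]]; last exact: (gaussian_minimizes ef nf c0 fE).
have [_ eqc] := fock_uncertainty a b ef nf.
move=> /eqc[f0|[c c0 uv]].
  by exists 1, 0; split=> // z; rewrite f0 mul0r.
by exists c, (f 0); split=> // z; exact: (minimizer_gaussian ef c0 uv).
Qed.
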